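(* Let $k$ be an integer, let $d_1,\ldots,d_{k-1}$ be positive integers with $d_1 > d_2 > \cdots > d_{k-2} \geqslant d_{k-1}$, and put $n =\sum_{1 \leqslant i \leqslant k-1}(2^{d_i}-1)$ and $m = \sum_{1 \leqslant i \leqslant k-2}(2^{d_i-d_{k-1}}-1)$. If $d_{k-1} \geqslant k-1 \geqslant 3$, then $$\dim_{\mathbb F_2} (QP_k)_n = (2^k-1)\dim_{\mathbb F_2} (QP_{k-1})_m.$$
   Context: $P_k=\mathbb F_2[x_1,\ldots,x_k]$ is the polynomial algebra with each $x_j$ of degree $1$, viewed as a module over the mod-2 Steenrod algebra $\mathcal A$ via $Sq^0(x_j)=x_j$, $Sq^1(x_j)=x_j^2$, $Sq^i(x_j)=0$ for $i\geqslant 2$, and the Cartan formula $Sq^n(fg)=\sum_{i=0}^n Sq^i(f)Sq^{n-i}(g)$. $\mathcal A^+$ is the augmentation ideal of $\mathcal A$, $QP_k=P_k/\mathcal A^+P_k$, and $(QP_k)_n$ is the subspace of $QP_k$ of classes represented by homogeneous polynomials of degree $n$. *)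

(* Defs.v *)
From HB Require Import structures.
From mathcomp Require Import all_boot all_order all_algebra.
From mathcomp Require Import mpoly.
From mathcomp Require Import boolp.

Set Implicit Arguments.
Unset Strict Implicit.
Unset Printing Implicit Defensive.

Import GRing.Theory VectorInternalTheory.
Local Open Scope ring_scope.
Local Open Scope quotient_scope.

Notation Palg k := {mpoly 'F_2[k]}.

Lemma vector_axiom_surj (F : finFieldType) (V : lmodType F) (N : nat)
    (g : {linear 'rV[F]_N -> V}) :
  (forall v, exists u, g u == v) -> {d : nat & Vector.axiom d V}.
Proof.
move=> g_surj.
pose s := [seq u <- enum {: 'rV[F]_N} | g u == 0].
pose K := <<in_tuple s>>%VS.
have KP u : (u \in K) = (g u == 0).
  apply/idP/eqP => [uK | gu0]; last first.
    by apply: memv_span; rewrite mem_filter gu0 eqxx mem_enum.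
  rewrite (coord_span uK) linear_sum big1 // => i _; rewrite linearZ /=.
  have /(mem_nth 0) : (i < size s)%N by [].
  by rewrite mem_filter => /andP[/eqP-> _]; rewrite scaler0.
pose C := (K^C)%VS; pose h (w : subvs_of C) := g (vsval w).
have h_lin : linear h by move=> c u w; rewrite /h !linearP.
have h_inj : injective h.
  move=> u w /eqP; rewrite -subr_eq0 -linearB -linearB /= -KP => uwK.
  have : vsval (u - w) \in (K :&: C)%VS by rewrite memv_cap subvsP andbT.
  rewrite capv_compl memv0 => /eqP uw0.
  by apply/eqP; rewrite -subr_eq0; apply/eqP/val_inj.
have h_surj v : exists w, h w == v.
  have [u /eqP guv] := g_surj v.
  have /memv_addP[x xK [y yC uxy]] : u \in (K + C)%VS.
    by rewrite addv_complf memvf.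
  exists (vsproj C y); rewrite /h vsprojK // -guv uxy linearD /=.
  by move: xK; rewrite KP => /eqP->; rewrite add0r.
pose r v := v2r (xchoose (h_surj v)).
have hK v : h (r2v (r v)) = v by rewrite v2rK; apply/eqP/(xchooseP (h_surj v)).
exists (dim (subvs_of C)), r.
  move=> c u v; apply: (can_inj r2vK); apply: h_inj.
  by rewrite linearP h_lin !hK.
exists (fun w => h (r2v w)) => // w.
by apply: (can_inj r2vK); apply: h_inj; rewrite hK.
Qed.

Section Steenrod.
Variable k : nat.

(* The total square, graded by an auxiliary variable 'X: the ring morphism
   P_k -> P_k['X] sending x_j to x_j + x_j^2 'X. Sq^i is its 'X^i-coefficient;
   SqX, SqD and Sq_Cartan are the defining properties of the squares, and
   Sq_unique says that they determine them. *)
Definition totalSq : Palg k -> {poly Palg k} :=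
  mmap (polyC \o @mpolyC k 'F_2) (fun j => ('X_j)%:P + ('X_j ^+ 2)%:P * 'X).

Definition Sq (i : nat) (f : Palg k) : Palg k := (totalSq f)`_i.

Lemma totalSqX (j : 'I_k) : totalSq 'X_j = ('X_j)%:P + ('X_j ^+ 2)%:P * 'X.
Proof. by rewrite /totalSq mmapX mmap1U. Qed.

Lemma totalSqD (f g : Palg k) : totalSq (f + g) = totalSq f + totalSq g.
Proof. exact: mmapD. Qed.

Lemma totalSqM (f g : Palg k) : totalSq (f * g) = totalSq f * totalSq g.
Proof. by rewrite /totalSq rmorphM. Qed.

Lemma totalSqZ (c : 'F_2) (f : Palg k) :
  totalSq (c *: f) = (c%:MP)%:P * totalSq f.
Proof. by rewrite /totalSq mmapZ. Qed.

Lemma SqX (i : nat) (j : 'I_k) :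
  Sq i 'X_j = if i == 0%N then 'X_j else if i == 1%N then 'X_j ^+ 2 else 0.
Proof.
rewrite /Sq totalSqX coefD coefMX !coefC.
by case: i => [|[|i]] /=; rewrite ?addr0 ?add0r.
Qed.

Lemma SqD (i : nat) (f g : Palg k) : Sq i (f + g) = Sq i f + Sq i g.
Proof. by rewrite /Sq totalSqD coefD. Qed.

Lemma SqZ (i : nat) (c : 'F_2) (f : Palg k) : Sq i (c *: f) = c *: Sq i f.
Proof. by rewrite /Sq totalSqZ coefCM mul_mpolyC. Qed.

Lemma Sq_Cartan (n : nat) (f g : Palg k) :
  Sq n (f * g) = \sum_(i < n.+1) Sq i f * Sq (n - i) g.
Proof. by rewrite /Sq totalSqM coefM. Qed.

Lemma Sq1 (i : nat) : Sq i 1 = if i == 0%N then 1 else 0.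
Proof. by rewrite /Sq /totalSq rmorph1 coef1; case: eqP. Qed.

Lemma F2P (c : 'F_2) : (c == 0) || (c == 1).
Proof. by case: c => [[|[|m]] hm]. Qed.

Lemma Sq_unique (T : nat -> Palg k -> Palg k) : (0 < k)%N ->
  (forall i f g, T i (f + g) = T i f + T i g) ->
  (forall j, T 0%N 'X_j = 'X_j) ->
  (forall j, T 1%N 'X_j = 'X_j ^+ 2) ->
  (forall i j, (2 <= i)%N -> T i 'X_j = 0) ->
  (forall n f g, T n (f * g) = \sum_(i < n.+1) T i f * T (n - i)%N g) ->
  forall i f, T i f = Sq i f.
Proof.
move=> k_gt0 TD TX0 TX1 TX2 TM.
have TX i j : T i 'X_j = Sq i 'X_j.
  by rewrite SqX; case: i => [|[|i]] //=; rewrite TX2.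
have T0 i : T i 0 = 0 by apply: (@addrI _ (T i 0)); rewrite -TD !addr0.
have T01 : T 0%N 1 = 1.
  have x_neq0 : ('X_(Ordinal k_gt0) : Palg k) != 0.
    by rewrite -msupp_eq0 msuppX.
  apply: (mulIf x_neq0); rewrite mul1r.
  by have := TM 0%N 1 'X_(Ordinal k_gt0); rewrite mul1r big_ord1 TX0.
have T1 i : T i 1 = Sq i 1.
  elim/ltn_ind: i => -[|n] IH; first by rewrite T01 Sq1.
  rewrite Sq1 /=; apply: (@addrI _ (T n.+1 1)); rewrite addr0.
  have := TM n.+1 1 1.
  rewrite mulr1 big_ord_recl big_ord_recr /= subn0 subnn T01 mul1r mulr1.
  rewrite big1 ?add0r => [<- //|j _].
  by rewrite IH ?Sq1 /= ?mul0r // /bump /= add1n ltnS.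
have TXm m i : T i 'X_[m] = Sq i 'X_[m].
  rewrite mpolyXE_id.
  elim/big_rec: _ i => [|j q _ IH] i; first exact: T1.
  elim: (m j) i => [|e IHe] i; first by rewrite expr0 mul1r.
  rewrite exprS -mulrA TM Sq_Cartan.
  by apply: eq_bigr => l _; rewrite TX IHe.
have TZ i c f : T i (c *: f) = c *: T i f.
  by case/orP: (F2P c) => /eqP->; rewrite ?scale0r ?scale1r.
have S0 i : Sq i 0 = 0 by rewrite -[in LHS](scale0r 1) SqZ scale0r.
move=> i f; rewrite (mpolyE f) (big_morph _ (TD i) (T0 i)).
rewrite (big_morph _ (SqD i) (S0 i)).
by apply: eq_bigr => m _; rewrite TZ SqZ TXm.
Qed.

Definition Sq_word (w : seq nat) (f : Palg k) : Palg k := foldr Sq f w.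

Lemma Sq_wordZ (w : seq nat) (c : 'F_2) (f : Palg k) :
  Sq_word w (c *: f) = c *: Sq_word w f.
Proof. by elim: w => //= i w ->; rewrite SqZ. Qed.

(* The submodule A^+ P_k. The Steenrod algebra A is generated by the squares,
   so its augmentation ideal A^+ is spanned by the monomials
   Sq^(i_1) ... Sq^(i_r) of positive degree i_1 + ... + i_r. *)
Definition is_hit (f : Palg k) : Prop :=
  exists2 s : seq (seq nat * Palg k), all (fun u => (0 < sumn u.1)%N) s &
    f = \sum_(u <- s) Sq_word u.1 u.2.

Definition hits : {pred Palg k} := [pred f | `[< is_hit f >]].

Lemma hits_submod_closed : submod_closed hits.
Proof.
split=> [|c f g /asboolP[s s_pos ->] /asboolP[t t_pos ->]]; apply/asboolP.
  by exists [::]; rewrite ?big_nil.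
exists ([seq (u.1, c *: u.2) | u <- s] ++ t).
  by rewrite all_cat all_map s_pos t_pos.
rewrite big_cat big_map scaler_sumr; congr (_ + _).
by apply: eq_bigr => u _; rewrite Sq_wordZ.
Qed.

HB.instance Definition _ := GRing.isSubmodClosed.Build 'F_2 (Palg k) hits
  hits_submod_closed.

Definition QP : Type := {ideal_quot hits}.

HB.instance Definition _ := GRing.Zmodule.on QP.

Definition QPclass (f : Palg k) : QP := \pi_({ideal_quot hits}) f.

Lemma QPclassD : {morph QPclass : f g / f + g}.
Proof. exact: raddfD. Qed.

Lemma QPclass_eq (f g : Palg k) : (QPclass f == QPclass g) = (f - g \in hits).
Proof. by rewrite Quotient.idealrBE. Qed.

Lemma QPclass_repr (q : QP) : QPclass (repr q) = q.
Proof. exact: reprK. Qed.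

Definition QPscale (c : 'F_2) (q : QP) : QP := QPclass (c *: repr q).

Lemma QPclassZ (c : 'F_2) (f : Palg k) : QPscale c (QPclass f) = QPclass (c *: f).
Proof.
apply/eqP; rewrite QPclass_eq -scalerBr rpredZ //.
by rewrite -QPclass_eq QPclass_repr.
Qed.

Lemma QPscaleA a b q : QPscale a (QPscale b q) = QPscale (a * b) q.
Proof. by rewrite -(QPclass_repr q) !QPclassZ scalerA. Qed.

Lemma QPscale1 : left_id 1 QPscale.
Proof. by move=> q; rewrite -(QPclass_repr q) QPclassZ scale1r. Qed.

Lemma QPscaleDr : right_distributive QPscale +%R.
Proof.
move=> c q r; rewrite -(QPclass_repr q) -(QPclass_repr r).
by rewrite -QPclassD !QPclassZ -QPclassD scalerDr.
Qed.

Lemma QPscaleDl q : {morph QPscale^~ q : a b / a + b}.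
Proof.
by move=> a b; rewrite -(QPclass_repr q) !QPclassZ -QPclassD scalerDl.
Qed.

HB.instance Definition _ := GRing.Zmodule_isLmodule.Build 'F_2 QP
  QPscaleA QPscale1 QPscaleDr QPscaleDl.

Lemma QPclass_is_linear : linear QPclass.
Proof. by move=> c f g; rewrite QPclassD -QPclassZ. Qed.

HB.instance Definition _ := GRing.isLinear.Build 'F_2 (Palg k) QP _ QPclass
  QPclass_is_linear.

Section Degree.
Variable n : nat.

Definition QPhomog : {pred QP} :=
  [pred q | `[< exists2 f : Palg k, f \is n.-homog & q = QPclass f >]].

Lemma QPhomog_submod_closed : submod_closed QPhomog.
Proof.
split=> [|c _ _ /asboolP[f fn ->] /asboolP[g gn ->]]; apply/asboolP.
  by exists 0; rewrite ?linear0 // rpred0.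
by exists (c *: f + g); rewrite ?linearP // rpredD ?rpredZ.
Qed.

HB.instance Definition _ := GRing.isSubmodClosed.Build 'F_2 QP QPhomog
  QPhomog_submod_closed.

(* (QP_k)_n, the subspace of classes of homogeneous polynomials of degree n. *)
Record QPdeg : predArgType := QPDeg { QPdeg_val : QP; _ : QPdeg_val \in QPhomog }.

HB.instance Definition _ := [isSub for QPdeg_val].
HB.instance Definition _ := [Choice of QPdeg by <:].
HB.instance Definition _ := [SubChoice_isSubLmodule of QPdeg by <:].

Definition QPdeg_gen (u : 'rV['F_2]_#|{: 'X_{1..k < n.+1}}|) : Palg k :=
  pihomog mdeg n
    (\sum_i u 0 i *: 'X_[(enum_val i : 'X_{1..k < n.+1}) : 'X_{1..k}]).

Fact QPdeg_gen_subproof u : QPclass (QPdeg_gen u) \in QPhomog.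
Proof. by apply/asboolP; exists (QPdeg_gen u) => //; apply: pihomogP. Qed.

Definition QPdeg_of_row u : QPdeg := QPDeg (QPdeg_gen_subproof u).

Fact QPdeg_of_row_is_linear : linear QPdeg_of_row.
Proof.
move=> c u v; apply: val_inj => /=; rewrite -linearP /= /QPdeg_gen.
rewrite -linearP /= scaler_sumr -big_split /=; congr (QPclass (pihomog _ _ _)).
by apply: eq_bigr => i _; rewrite !mxE scalerDl scalerA.
Qed.

HB.instance Definition _ := GRing.isLinear.Build 'F_2 _ QPdeg _ QPdeg_of_row
  QPdeg_of_row_is_linear.

Fact QPdeg_vect_iso : {d : nat & Vector.axiom d QPdeg}.
Proof.
apply: (vector_axiom_surj (g := QPdeg_of_row)) => -[q qn].
have /asboolP[f fn def_q] := qn.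
exists (\row_i f@_(enum_val i : 'X_{1..k < n.+1})).
apply/eqP/val_inj; rewrite /= def_q /QPdeg_gen; congr (QPclass _).
rewrite -[RHS](pihomog_dE fn); congr (pihomog _ _ _).
rewrite [RHS](mpolywE (k := n.+1)); last first.
  rewrite msizeE; apply/bigmax_leqP_seq => m m_f _.
  by rewrite (dhomog_mf fn m_f).
rewrite (reindex (fun i : 'I_#|{: 'X_{1..k < n.+1}}| => enum_val i)) /=.
  by apply: eq_bigr => i _; rewrite mxE.
exact/onW_bij/enum_val_bij.
Qed.

HB.instance Definition _ := Lmodule_hasFinDim.Build 'F_2 QPdeg
  (projT2 QPdeg_vect_iso).

End Degree.
End Steenrod.

(* Main.v *)
Require Import Defs.
From HB Require Import structures.
From mathcomp Require Import all_boot all_order all_algebra.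
From mathcomp Require Import mpoly boolp.
From mathcomp Require Import zify ring.

(** Write K for the number of variables (the letter k of the theorem; from
    [Section Restriction] on, k denotes K - 1), X for the product of all
    variables, d for the last exponent and V* for the nonzero linear forms,
    which correspond to the nonempty sets B of variables through
    x_B = sum of the x_i, i in B. The idea is that restriction to the 2^K - 1
    hyperplanes x_B = 0, followed by d applications of Kameko's map, is an
    isomorphism from (QP_K)_n onto the product of 2^K - 1 copies of
    (QP_(K-1))_m.

    The map exists because substitution of linear forms and Kameko's map
    preserve hits ([lsubst_hits], [kameko_hits]).

    To compute with it, put [j] y = (X / x_j) y^2. Let J be a sequence of d
    indices. The degree n is that of a spike with K - 1 variables, so every
    monomial of degree n that is not of the form [J] y is hit, by the arguments
    of Wood and of Kameko ([hitmod_hits]). Hence (QP_K)_n is spanned by the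
    classes of the [J] y. At B, the map sends [J] y to u_J(B) times the
    restriction of y, where u_J is the product of the coordinate functions
    u_j, j in J, on V* ([Phi_digits]).

    The source satisfies the relations that this formula suggests.
    Modulo hits, [J] y depends only on the set of the entries of J
    ([digits_eq_mem]), as u_J does; it vanishes for y hit ([hits_digits]);
    and the sum over l of [J, l] (x_l y) vanishes ([spread_sum]), since the sum
    of the u_l x_l is the universal linear form, which restricts to 0
    everywhere. All this follows from the single identity
    Sq^1 (X y^2) = sum of the [l] (x_l y) and from the Cartan formula.

    So an element of the source is a function on V* with values in the
    polynomials of degree m. If d >= K the functions u_J are all the functions
    on V*; if d = K - 1 they are those with sum 0, and in both cases families
    with sum 0 suffice ([balanced], [Psi_onto]).
    Surjectivity: since m > 0, a polynomial placed at B can be balanced by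
    monomials placed at variables that divide them ([lift_family]).
    Injectivity: a family that restricts to hits is, up to a family of hits, a
    family of multiples x_B q_B with sum 0. The relations move it to the
    variables, where it becomes a syzygy of x_1, ..., x_K, hence a combination
    of Koszul syzygies. These vanish, because Sq^1 of a relation is made of hits
    and differs from another relation by a Koszul syzygy ([Psi_koszul],
    [Psi_lform], [Psi_restr_hits]). *)

Set Implicit Arguments.
Unset Strict Implicit.
Unset Printing Implicit Defensive.

Import GRing.Theory.
Local Open Scope ring_scope.

(** * Steenrod squares and hit polynomials *)

(** Locked, like the squares [sq]: conversion would otherwise compare two such
    expressions by unfolding them down to the coefficients. *)
HB.lock Definition hcomp (k e : nat) (f : {mpoly 'F_2[k]}) := pihomog mdeg e f.

HB.lock Definition sq (k i : nat) (f : {mpoly 'F_2[k]}) := Sq i f.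

Section Squares.
Variable k : nat.
Local Notation P := {mpoly 'F_2[k]}.

Lemma mpoly2_supp_ind (Q : P -> Prop) (f : P) :
  Q 0 -> (forall g h, Q g -> Q h -> Q (g + h)) ->
  (forall m, m \in msupp f -> Q 'X_[m]) -> Q f.
Proof.
move=> Q0 QD QX; rewrite (mpolyE f) big_seq; apply: big_ind => // m mf.
have /orP[/eqP->|/eqP->] := F2P f@_m; rewrite ?scale0r ?scale1r //.
exact: QX.
Qed.

Lemma mpoly2_ind (Q : P -> Prop) :
  Q 0 -> (forall g h, Q g -> Q h -> Q (g + h)) ->
  (forall m, Q 'X_[m]) -> forall f, Q f.
Proof. by move=> Q0 QD QX f; apply: mpoly2_supp_ind. Qed.

Lemma mnm_neq0 (m : 'X_{1..k}) : m != 0%MM -> exists i, m i != 0%N.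
Proof.
move=> m_neq0; apply/existsP; apply: contraNT m_neq0; rewrite negb_exists => /forallP m0.
by apply/eqP/mnmP => i; rewrite mnm0E; apply/eqP; have := m0 i; rewrite negbK.
Qed.

Lemma mnm_ind (Q : 'X_{1..k} -> Prop) :
  Q 0%MM -> (forall i m, Q m -> Q (U_(i) + m)%MM) -> forall m, Q m.
Proof.
move=> Q0 QS m; have [n] := ubnP (mdeg m); elim: n m => // n IH m lt_m.
have [->//|m_neq0] := eqVneq m 0%MM.
have [i mi] := mnm_neq0 m_neq0.
have le_im : (U_(i) <= m)%MM by rewrite lep1mP.
rewrite -(submK le_im) addmC; apply: QS; apply: IH.
by move: lt_m; rewrite -{1}(submK le_im) mdegD mdeg1 addn1.
Qed.

Lemma natr2_F2 : 2%:R = 0 :> 'F_2. Proof. exact/val_inj. Qed.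

Lemma mpolyDD (f : P) : f + f = 0.
Proof. by rewrite -mulr2n -scaler_nat natr2_F2 scale0r. Qed.

Lemma mpolyN (f : P) : - f = f.
Proof. by apply/eqP; rewrite eq_sym -addr_eq0 mpolyDD. Qed.

Lemma mpoly_sqrD (f g : P) : (f + g) ^+ 2 = f ^+ 2 + g ^+ 2.
Proof. by rewrite sqrrD mulr2n mpolyDD addr0. Qed.

Lemma polyDD (p : {poly P}) : p + p = 0.
Proof. by apply/polyP => i; rewrite coefD mpolyDD coef0. Qed.

Lemma coef_sqr (p : {poly P}) (n : nat) :
  (p ^+ 2)`_n = if odd n then 0 else p`_n./2 ^+ 2.
Proof.
elim/poly_ind: p n => [|p c IH] n.
  by rewrite expr0n /= !coef0; case: ifP; rewrite // expr2 mul0r.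
rewrite sqrrD mulr2n polyDD addr0 exprMn coefD coefMXn -polyC_exp coefC.
case: n => [|[|n]] /=; first by rewrite add0r coefD coefMX coefC /= add0r.
  by rewrite add0r.
rewrite addr0 subSS subSS subn0 IH negbK coefD coefMX coefC /= addr0.
by case: ifP.
Qed.

Fact sq_is_linear (i : nat) : linear (@sq k i).
Proof. by move=> c f g; rewrite sq.unlock SqD SqZ. Qed.

HB.instance Definition _ (i : nat) :=
  GRing.isLinear.Build 'F_2 P P _ (@sq k i) (sq_is_linear i).

Lemma sqD i : {morph @sq k i : f g / f + g}.
Proof. exact: raddfD. Qed.

Lemma sqf0 i : sq i (0 : P) = 0.
Proof. exact: raddf0. Qed.

Lemma sq1 (i : nat) : sq i (1 : P) = if i == 0%N then 1 else 0.
Proof. by rewrite sq.unlock Sq1. Qed.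

Lemma sqX (i : nat) (j : 'I_k) : sq i ('X_j : P) =
  if i == 0%N then 'X_j else if i == 1%N then 'X_j ^+ 2 else 0.
Proof. by rewrite sq.unlock SqX. Qed.

Lemma sqM (n : nat) (f g : P) :
  sq n (f * g) = \sum_(i < n.+1) sq i f * sq (n - i) g.
Proof. by rewrite sq.unlock Sq_Cartan. Qed.

Lemma sq0 (f : P) : sq 0 f = f.
Proof.
elim/mpoly2_ind: f => [|f g IHf IHg|m]; first by rewrite raddf0.
  by rewrite raddfD /= IHf IHg.
elim/mnm_ind: m => [|i m IH]; first by rewrite mpolyX0 sq1.
by rewrite mpolyXD sqM big_ord1 sqX IH.
Qed.

Lemma sqMX (n : nat) (i : 'I_k) (f : P) :
  sq n.+1 ('X_i * f) = 'X_i * sq n.+1 f + 'X_i ^+ 2 * sq n f.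
Proof.
rewrite sqM big_ord_recl sqX /= subn0; congr (_ + _).
rewrite big_ord_recl sqX /= subn1 big1 ?addr0 // => j _.
by rewrite sqX mul0r.
Qed.

Lemma sq_sqr (n : nat) (f : P) :
  sq n (f ^+ 2) = if odd n then 0 else sq n./2 f ^+ 2.
Proof. by rewrite sq.unlock /Sq expr2 totalSqM -expr2 coef_sqr. Qed.

Lemma sqX_homog (n : nat) (m : 'X_{1..k}) :
  sq n ('X_[m] : P) \is (mdeg m + n).-homog.
Proof.
elim/mnm_ind: m n => [|i m IH] n.
  rewrite mpolyX0 sq1; case: eqP => [->|_]; last exact: rpred0.
  by rewrite mdeg0; exact: dhomog1.
case: n => [|n].
  by rewrite sq0 addn0 dhomogX.
rewrite mpolyXD sqMX mdegD mdeg1; apply: rpredD.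
  rewrite -addnA; apply: dhomogM (IH _).
  by rewrite dhomogX; apply/eqP; exact: mdeg1.
rewrite add1n addSnnS; have -> : (mdeg m + n.+2 = 2 + (mdeg m + n))%N by lia.
apply: dhomogM (IH _); rewrite mpolyXn dhomogX.
by apply/eqP; rewrite /= mdegMn mdeg1.
Qed.

Lemma sq_homog (n e : nat) (f : P) :
  f \is e.-homog -> sq n f \is (e + n).-homog.
Proof.
move=> /dhomogP f_e; rewrite (mpolyE f) linear_sum big_seq /=.
by apply: rpred_sum => m mf; rewrite linearZ rpredZ //= -(f_e _ mf) sqX_homog.
Qed.

Lemma sq_gt_deg (n : nat) (m : 'X_{1..k}) :
  (mdeg m < n)%N -> sq n ('X_[m] : P) = 0.
Proof.
elim/mnm_ind: m n => [|i m IH] [|n] //.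
  by rewrite mpolyX0 sq1.
rewrite mdegD mdeg1 ltnS add1n => lt_mn.
by rewrite mpolyXD sqMX !IH ?mulr0 ?addr0 //; lia.
Qed.

Lemma sq_deg (m : 'X_{1..k}) : sq (mdeg m) ('X_[m] : P) = 'X_[m] ^+ 2.
Proof.
elim/mnm_ind: m => [|i m IH]; first by rewrite mdeg0 sq0 mpolyX0 expr1n.
rewrite mdegD mdeg1 add1n mpolyXD sqMX IH exprMn sq_gt_deg //.
by rewrite mulr0 add0r.
Qed.

Lemma sqX_pow2 (n a : nat) (i : 'I_k) :
  sq n ('X_i ^+ (2 ^ a) : P) =
  if n == 0%N then 'X_i ^+ (2 ^ a)
  else if n == (2 ^ a)%N then 'X_i ^+ (2 ^ a.+1) else 0.
Proof.
elim: a n => [|a IH] n; first by rewrite expn0 expr1 sqX.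
rewrite expnSr exprM sq_sqr IH muln2; case: ifP => odd_n.
  case: eqP odd_n => [->//|_]; case: eqP => [->|//].
  by rewrite odd_double.
have -> : (n./2 == 0)%N = (n == 0)%N by lia.
have -> : (n./2 == 2 ^ a)%N = (n == (2 ^ a).*2)%N by lia.
by do 2?case: eqP => _; rewrite ?expr0n -?exprM ?[(2 ^ _.+2)%N]expnSr ?expnSr.
Qed.

Lemma sq_hit (i : nat) (f : P) : (0 < i)%N -> sq i f \in @hits k.
Proof.
move=> i_gt0; apply/asboolP; exists [:: ([:: i], f)] => /=.
  by rewrite addn0 i_gt0.
by rewrite big_seq1 sq.unlock.
Qed.

Lemma hits_ind (Q : P -> Prop) (f : P) :
  Q 0 -> (forall g h, Q g -> Q h -> Q (g + h)) ->
  (forall i g, (0 < i)%N -> Q (sq i g)) -> f \in @hits k -> Q f.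
Proof.
move=> Q0 QD QS /asboolP[s /allP s_pos ->].
rewrite big_seq; apply: big_ind => // -[w g] /s_pos /=.
elim: w => //= i w IH; have := QS i (Sq_word w g).
rewrite sq.unlock; case: i => [_|i QSi _]; last exact: QSi.
by have := sq0 (Sq_word w g); rewrite sq.unlock => ->.
Qed.

Lemma hcompD e : {morph @hcomp k e : f g / f + g}.
Proof. by move=> f g; rewrite hcomp.unlock; exact: pihomogD. Qed.

Lemma hcomp0 e : hcomp e 0 = 0 :> P.
Proof. by rewrite hcomp.unlock; exact: pihomog0. Qed.

Lemma hcompX e m : hcomp e 'X_[m] = if mdeg m == e then 'X_[m] else 0 :> P.
Proof. by rewrite hcomp.unlock; exact: pihomogX. Qed.

Lemma hcomp_homog e (f : P) : hcomp e f \is e.-homog.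
Proof. by rewrite hcomp.unlock; exact: pihomogP. Qed.

Lemma hcomp_id e (f : P) : f \is e.-homog -> hcomp e f = f.
Proof. by rewrite hcomp.unlock; exact: pihomog_dE. Qed.

Lemma hcomp_neq e e' (f : P) : e' != e -> f \is e'.-homog -> hcomp e f = 0.
Proof. by rewrite hcomp.unlock => ? ?; exact: (@pihomog_ne0 _ _ mdeg e'). Qed.

Lemma hcomp_sq (e i : nat) (f : P) :
  hcomp e (sq i f) = if (i <= e)%N then sq i (hcomp (e - i) f) else 0.
Proof.
elim/mpoly2_ind: f => [|f g IHf IHg|m].
- by rewrite !(hcomp0, raddf0) if_same.
- rewrite sqD !hcompD IHf IHg.
  by case: ifP => _; rewrite ?sqD ?addr0.
rewrite hcompX; case: eqP => [m_e|/eqP m_e].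
  have := sqX_homog i m.
  case: leqP => le_ie; first by rewrite m_e subnK // => /hcomp_id.
  by move/hcomp_neq => -> //; lia.
rewrite raddf0 if_same.
have /hcomp_neq-> // := sqX_homog i m.
by apply: contraNneq m_e => <-; rewrite addnK.
Qed.

Lemma hits_hcomp (e : nat) (f : P) : f \in @hits k -> hcomp e f \in @hits k.
Proof.
elim/hits_ind => [|g h IHg IHh|i g i_gt0].
- by rewrite hcomp0 rpred0.
- by rewrite hcompD rpredD.
rewrite hcomp_sq; case: ifP => _; last exact: rpred0.
exact: sq_hit.
Qed.

(** A square acts on the factor x^(2^a) by keeping it or by turning it into
    x^(2^(a+1)), so this span, of the products of x_i^(2^(a_i)) for i in [s], is
    closed under all squares. It is where the conjugate squares of a squarefree
    monomial live. *)
Inductive pow2_span : seq 'I_k -> P -> Prop :=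
| Pow2Span0 s : pow2_span s 0
| Pow2SpanD s f g : pow2_span s f -> pow2_span s g -> pow2_span s (f + g)
| Pow2Span1 : pow2_span [::] 1
| Pow2SpanM i s a f :
    pow2_span s f -> pow2_span (i :: s) ('X_i ^+ (2 ^ a) * f).

Lemma pow2_span_sq s f n : pow2_span s f -> pow2_span s (sq n f).
Proof.
move=> sf; elim: sf n => {s f} [s|s f g _ IHf _ IHg||i s a f _ IHf] n.
- by rewrite raddf0; constructor.
- by rewrite sqD; constructor.
- by rewrite sq1; case: ifP => _; constructor.
rewrite sqM; apply: big_ind => [||j _]; try by constructor.
rewrite sqX_pow2; do 2?case: ifP => _; try by constructor.
by rewrite mul0r; constructor.
Qed.

Lemma pow2_span_supp s f m : pow2_span s f -> uniq s -> m \in msupp f ->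
  exists a : 'I_k -> nat, forall i, m i = if i \in s then (2 ^ a i)%N else 0%N.
Proof.
move=> sf; elim: sf m => {s f} [s|s f g _ IHf _ IHg||i s a f _ IHf] m.
- by rewrite msupp0.
- by move=> us /msuppD_le; rewrite mem_cat => /orP[/IHf|/IHg]; apply.
- by rewrite msupp1 inE => _ /eqP->; exists (fun=> 0%N) => i; rewrite mnm0E.
rewrite /= => /andP[is_ us]; rewrite mulrC mpolyXn => /msuppM_le.
rewrite msuppX => /allpairsP[[m1 m2] /= [m1_f]].
rewrite inE => /eqP-> ->; have [b def_m1] := IHf m1 us m1_f.
exists (fun j => if j == i then a else b j) => j.
rewrite mnmDE def_m1 mulmnE mnm1E inE eq_sym.
by case: eqP => [->|_]; rewrite ?(negbTE is_) ?mul1n ?mul0n ?addn0.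
Qed.

(** Modulo hits, the Cartan formula moves Sq^i from [v] onto [f] in smaller and
    smaller steps. Of the resulting conjugate square of [f], only the span and
    the degree are recorded. *)
Lemma pow2_span_transfer s f e i v : pow2_span s f -> f \is e.-homog ->
  exists f', [/\ pow2_span s f', f' \is (e + i).-homog &
                 f * sq i v - f' * v \in @hits k].
Proof.
elim/ltn_ind: i f e => i IH f e sf fe.
case: i IH => [|i] IH.
  by exists f; rewrite sq0 subrr rpred0 addn0.
have := sq_hit (f * v) (ltn0Sn i); rewrite sqM big_ord_recl sq0 subn0.
set R := \sum_(j < _) _ => hit_R.
have [f' [sf' f'e Rf']] : exists f', [/\ pow2_span s f',
    f' \is (e + i.+1).-homog & R - f' * v \in @hits k].
  rewrite /R; elim/big_ind: _ => [|g h [g' [sg g'e hg]] [h' [sh h'e hh]]|j _].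
  - by exists 0; rewrite mul0r subrr !rpred0; split=> //; constructor.
  - exists (g' + h'); split; [by constructor | exact: rpredD |].
    by rewrite mulrDl opprD addrACA rpredD.
  have [|||f' [sf' f'e]] := IH (i - j)%N _ (sq j.+1 f) (e + j.+1)%N.
  - by rewrite ltnS leq_subr.
  - exact: pow2_span_sq.
  - exact: sq_homog.
  have e_eq : (e + j.+1 + (i - j) = e + i.+1)%N by have := ltn_ord j; lia.
  rewrite e_eq in f'e.
  by exists f'; split=> //; rewrite lift0 subSS.
exists f'; split=> //; rewrite -[X in X - _](addrK R) (mpolyN R) -addrA.
by rewrite rpredD.
Qed.

End Squares.

(** * Monomials digit by digit *)

(** The exponent of X / x_j, where X is the product of all variables. *)
Definition all_but (k : nat) (j : 'I_k) : 'X_{1..k} := [multinom (i != j : nat) | i < k].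

(** The operation [j] y = (X / x_j) y^2. On a monomial it prepends a lowest binary
    digit to the exponents, equal to 1 for every variable except x_j. *)
HB.lock Definition digit (k : nat) (j : 'I_k) (y : {mpoly 'F_2[k]}) :=
  'X_[all_but j] * y ^+ 2.

Definition digits (k : nat) (J : seq 'I_k) (y : {mpoly 'F_2[k]}) := foldr (@digit k) y J.

Arguments digits : simpl never.

Definition half_mnm (k : nat) (m : 'X_{1..k}) : 'X_{1..k} := [multinom (m i)./2 | i < k].

Definition odd_vars (k : nat) (m : 'X_{1..k}) : {set 'I_k} := [set i | odd (m i)].

(** Each of the [d] lowest binary digits is 1 in the exponents of all variables but
    one. These monomials are the values of [digits J] with [J] of size [d]. *)
Fixpoint full_digits (k d : nat) (m : 'X_{1..k}) : bool :=
  if d is d'.+1 then (#|odd_vars m| == k.-1) && full_digits d' (half_mnm m) else true.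

Section Weights.
Variable k : nat.
Local Notation P := {mpoly 'F_2[k]}.

Definition deficient (d : nat) (f : P) : Prop :=
  forall m, m \in msupp f -> ~~ full_digits d m.

(** The congruence in which the relations between the [digits J y] are proved.
    Monomials without full digits are set to 0 along with the hits; [hitmod_hits]
    shows that they are hit in the degrees of interest. *)
Definition hitmod (d : nat) : {pred P} :=
  [pred f | `[< exists h b, [/\ h \in @hits k, deficient d b & f = h + b] >]].

Lemma deficientD d f g : deficient d f -> deficient d g -> deficient d (f + g).
Proof.
move=> df dg m /msuppD_le; rewrite mem_cat => /orP[]; [exact: df | exact: dg].
Qed.

Lemma deficient0 d : deficient d 0.
Proof. by move=> m; rewrite msupp0. Qed.

Lemma hitmod_submod_closed d : submod_closed (hitmod d).
Proof.
have mod0 : 0 \in hitmod d.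
  apply/asboolP; exists 0, 0; rewrite addr0 rpred0; split=> //.
  exact: deficient0.
split=> // c f g /asboolP[h [b [hh db ->]]] /asboolP[h' [b' [hh' db' ->]]].
apply/asboolP; exists (c *: h + h'), (c *: b + b').
rewrite scalerDr addrACA rpredD ?rpredZ //; split=> //.
apply: deficientD => //.
by have /orP[/eqP->|/eqP->] := F2P c; rewrite ?scale0r ?scale1r // => m; rewrite msupp0.
Qed.

HB.instance Definition _ d := GRing.isSubmodClosed.Build 'F_2 P (hitmod d)
  (hitmod_submod_closed d).

Lemma hits_hitmod d f : f \in @hits k -> f \in hitmod d.
Proof.
move=> hf; apply/asboolP; exists f, 0; rewrite addr0; split=> //.
exact: deficient0.
Qed.

Lemma deficient_hitmod d f : deficient d f -> f \in hitmod d.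
Proof. by move=> df; apply/asboolP; exists 0, f; rewrite add0r rpred0. Qed.

Lemma hitmodX d m : ~~ full_digits d m -> 'X_[m] \in hitmod d.
Proof.
by move=> dm; apply: deficient_hitmod => m'; rewrite msuppX inE => /eqP->.
Qed.

Lemma hitmod_ind (Q : P -> Prop) d f :
  (forall g h, Q g -> Q h -> Q (g + h)) -> (forall g, g \in @hits k -> Q g) ->
  (forall m, ~~ full_digits d m -> Q 'X_[m]) -> f \in hitmod d -> Q f.
Proof.
move=> QD Qh QX /asboolP[h [b [hh db ->]]]; apply: (QD); first exact: Qh.
apply: (@mpoly2_supp_ind k Q) => //; first by apply: Qh; rewrite rpred0.
by move=> m mb; apply: QX; apply: db.
Qed.

Lemma full_digits_le d e (m : 'X_{1..k}) : (d <= e)%N ->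
  full_digits e m -> full_digits d m.
Proof.
elim: d e m => [|d IH] [|e] m //= le_de /andP[-> /=].
exact: IH.
Qed.

Lemma hitmod_le d e f : (d <= e)%N -> f \in hitmod d -> f \in hitmod e.
Proof.
move=> le_de; elim/hitmod_ind => [g h||m dm]; first exact: rpredD.
  exact: hits_hitmod.
by apply: hitmodX; apply: contra dm; apply: full_digits_le.
Qed.

Lemma digitD j : {morph @digit k j : f g / f + g}.
Proof. by move=> f g; rewrite digit.unlock mpoly_sqrD mulrDr. Qed.

Lemma digit0 j : digit j 0 = 0 :> P.
Proof. by rewrite digit.unlock expr2 mul0r mulr0. Qed.

HB.instance Definition _ j := GRing.isNmodMorphism.Build P P (@digit k j)
  (conj (digit0 j) (digitD j)).

Lemma digitX j m : digit j 'X_[m] = 'X_[all_but j + m *+ 2] :> P.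
Proof. by rewrite digit.unlock mpolyXn -mpolyXD. Qed.

Lemma digits_cons j J (f : P) : digits (j :: J) f = digit j (digits J f).
Proof. by []. Qed.

Lemma digitsD J : {morph @digits k J : f g / f + g}.
Proof. by elim: J => // j J IH f g; rewrite !digits_cons IH digitD. Qed.

Lemma digits0 J : digits J 0 = 0 :> P.
Proof. by elim: J => // j J IH; rewrite digits_cons IH digit0. Qed.

HB.instance Definition _ J := GRing.isNmodMorphism.Build P P (@digits k J)
  (conj (digits0 J) (digitsD J)).

Lemma digits_cat J1 J2 (f : P) : digits (J1 ++ J2) f = digits J1 (digits J2 f).
Proof. exact: foldr_cat. Qed.

Lemma odd_vars_digit j (m : 'X_{1..k}) : odd_vars (all_but j + m *+ 2) = [set~ j].
Proof.
apply/setP => i; rewrite !inE mnmDE mnmE mulmnE muln2 oddD odd_double addbF.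
by case: eqP.
Qed.

Lemma card_setC1 (j : 'I_k) : #|[set~ j]| = k.-1.
Proof. by rewrite cardsC1 card_ord. Qed.

Lemma half_mnm_digit j (m : 'X_{1..k}) : half_mnm (all_but j + m *+ 2) = m.
Proof.
apply/mnmP => i; rewrite mnmE mnmDE mnmE mulmnE muln2.
by rewrite halfD odd_double andbF doubleK; case: eqP.
Qed.

Lemma full_digits_digit d j (m : 'X_{1..k}) :
  full_digits d.+1 (all_but j + m *+ 2) = full_digits d m.
Proof. by rewrite /= odd_vars_digit card_setC1 eqxx half_mnm_digit. Qed.

Lemma msupp_sqr (f : P) m : m \in msupp (f ^+ 2) -> forall i, odd (m i) = false.
Proof.
elim/mpoly2_ind: f m => [|f g IHf IHg|m'] m; first by rewrite expr2 mul0r msupp0.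
  by rewrite mpoly_sqrD => /msuppD_le; rewrite mem_cat => /orP[/IHf|/IHg].
by rewrite mpolyXn msuppX inE => /eqP-> i; rewrite mulmnE muln2 odd_double.
Qed.

Lemma pow2_span_set (T : {set 'I_k}) (m : 'X_{1..k}) :
  (forall i, m i = (i \in T)) -> pow2_span (enum T) ('X_[m] : P).
Proof.
move=> def_m.
have -> : 'X_[m] = \prod_(i <- enum T) 'X_i ^+ (2 ^ 0) :> P.
  rewrite mpolyXE_id big_enum /= [RHS]big_mkcond /=.
  by apply: eq_bigr => i _; rewrite def_m; case: ifP.
elim: (enum T) => [|i s IH]; first by rewrite big_nil; constructor.
by rewrite big_cons; constructor.
Qed.

Lemma mdeg_set (T : {set 'I_k}) (m : 'X_{1..k}) : (forall i, m i = (i \in T)) ->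
  mdeg m = #|T|.
Proof.
move=> def_m; rewrite mdegE -sum1_card [RHS]big_mkcond /=.
by apply: eq_bigr => i _; rewrite def_m; case: ifP.
Qed.

Lemma dhomog_set (T : {set 'I_k}) (m : 'X_{1..k}) :
  (forall i, m i = (i \in T)) -> ('X_[m] : P) \is #|T|.-homog.
Proof. by move=> def_m; rewrite dhomogX; apply/eqP; exact: mdeg_set. Qed.

(** In (X / x_j) (Sq^i g)^2 = (X / x_j) Sq^(2i) (g^2) the square moves onto X / x_j.
    That raises the degree of this factor, so at least one of its variables gets
    an even exponent and the lowest digit is no longer full. *)
Lemma hits_digit j y : y \in @hits k -> digit j y \in hitmod 1.
Proof.
elim/hits_ind => [|g h gP hP|i g i_gt0]; first by rewrite digit0 rpred0.
  by rewrite digitD rpredD.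
rewrite digit.unlock -{1}[i]doubleK.
have <- : sq i.*2 (g ^+ 2) = sq i.*2./2 g ^+ 2 by rewrite sq_sqr odd_double.
set T := [set~ j].
have butT i' : all_but j i' = (i' \in T) by rewrite mnmE !inE.
have homT : ('X_[all_but j] : P) \is (k.-1).-homog.
  by rewrite -(card_setC1 j); exact: dhomog_set.
have spanT := pow2_span_set butT.
have [f' [sf' f'_deg hf']] := pow2_span_transfer i.*2 (g ^+ 2) spanT homT.
rewrite -(subrK (f' * g ^+ 2) ('X_[all_but j] * _)).
apply: rpredD; first exact: hits_hitmod.
apply: deficient_hitmod => m /msuppM_le /allpairsP[[m1 m2] /= [m1_f m2_g ->]].
rewrite andbT; apply/negP => /eqP odds_m.
have [a def_m1] := pow2_span_supp sf' (enum_uniq _) m1_f.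
have odd_m i' : odd ((m1 + m2)%MM i') = (i' \in T) && (a i' == 0%N).
  rewrite mnmDE oddD (msupp_sqr m2_g) addbF def_m1 mem_enum.
  by case: ifP; rewrite // oddX orbF.
have sub_T : odd_vars (m1 + m2) \subset T.
  by apply/subsetP => i'; rewrite inE odd_m => /andP[].
(* A full lowest digit would force m1 to be the exponent of X / x_j itself,
   of too low a degree. *)
have /eqP eq_T : odd_vars (m1 + m2) == T.
  by rewrite eqEcard sub_T odds_m card_setC1 /=.
have def_m1T i' : m1 i' = (i' \in T).
  rewrite def_m1 mem_enum; case: ifP => // i'T.
  by have := odd_m i'; have := i'T; rewrite -{1}eq_T inE i'T => -> /esym/eqP->.
have := dhomog_mf f'_deg m1_f.
by rewrite /= (mdeg_set def_m1T) card_setC1; lia.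
Qed.

Lemma hitmod_digit d j y : y \in hitmod d -> digit j y \in hitmod d.+1.
Proof.
elim/hitmod_ind => [f g fP gP|f /hits_digit hf|m dm].
- by rewrite digitD rpredD.
- exact: hitmod_le (hf j).
by rewrite digitX hitmodX // full_digits_digit.
Qed.

Lemma hitmod_digits d J y : y \in hitmod d -> digits J y \in hitmod (size J + d).
Proof. by move=> dy; elim: J => // j J; rewrite digits_cons; apply: hitmod_digit. Qed.

Lemma hits_digits J y : y \in @hits k -> digits J y \in hitmod (size J).
Proof. by move/(hits_hitmod 0)/(hitmod_digits J); rewrite addn0. Qed.

Lemma sq1X (m : 'X_{1..k}) : sq 1 ('X_[m] : P) = \sum_l ('X_l * 'X_[m]) *+ m l.
Proof.
elim/mnm_ind: m => [|i m IH].
  by rewrite mpolyX0 sq1 big1 // => l _; rewrite mnm0E.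
rewrite mpolyXD sqMX sq0 IH mulr_sumr.
under [in RHS]eq_bigr do rewrite mnmDE mulrnDr.
rewrite big_split /= [LHS]addrC; congr (_ + _).
  rewrite (bigD1 i) //= mnm1E eqxx big1 ?addr0; first by rewrite mulr1n mulrA.
  by move=> l /negbTE l_i; rewrite mnm1E eq_sym l_i.
by apply: eq_bigr => l _; rewrite mulrnAr mulrCA.
Qed.

Definition all_vars : 'X_{1..k} := [multinom 1%N | i < k].

Lemma all_butD j : (U_(j) + all_but j)%MM = all_vars.
Proof. by apply/mnmP => i; rewrite mnmDE mnm1E !mnmE eq_sym; case: eqP. Qed.

Lemma sq1_all_vars (y : P) :
  sq 1 ('X_[all_vars] * y ^+ 2) = \sum_l 'X_l * ('X_[all_vars] * y ^+ 2).
Proof.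
rewrite sqM big_ord_recl big_ord1 /= sq0 subn0 sq_sqr /= mulr0 add0r subnn sq0.
rewrite sq1X mulr_suml; apply: eq_bigr => l _.
by rewrite mnmE mulr1n mulrA.
Qed.

Lemma digit_mulX l (y : P) : digit l ('X_l * y) = 'X_l * ('X_[all_vars] * y ^+ 2).
Proof.
rewrite digit.unlock exprMn -(all_butD l) mpolyXD ['X_l ^+ 2]expr2 -!mulrA mulrCA.
by congr (_ * _); rewrite mulrCA.
Qed.

(** By [digit_mulX] the sum is that of the x_l X Y^2 for a single [Y], and this is
    Sq^1 (X Y^2), because Sq^1 is a derivation that kills squares. *)
Lemma hit_sum_nseq c (y : P) : (0 < c)%N ->
  \sum_l digits (nseq c l) ('X_l * y) \in @hits k.
Proof.
case: c => // c _; pose Y := iter c (fun y : P => 'X_[all_vars] * y ^+ 2) y.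
have opsE l : digits (nseq c l) ('X_l * y) = 'X_l * Y.
  rewrite /Y; elim: (c) => // e IH.
  by rewrite -[nseq _ _]/(l :: nseq e l) digits_cons IH digit_mulX.
under eq_bigr do rewrite -[nseq _ _]/(_ :: nseq c _) digits_cons opsE digit_mulX.
by rewrite -sq1_all_vars sq_hit.
Qed.

Lemma mulX_deficient l i j (z : P) : i != j -> l != i -> l != j ->
  'X_l * ('X_[all_vars - U_(i) - U_(j)] * z ^+ 2) \in hitmod 1.
Proof.
move=> ij li lj; rewrite mulrA -mpolyXD; apply: deficient_hitmod.
move=> m /msuppM_le /allpairsP[[m1 m2] /= [m1_f m2_z ->]].
move: m1_f; rewrite msuppX inE => /eqP->; rewrite andbT.
have : odd_vars (U_(l) + (all_vars - U_(i) - U_(j)) + m2) \subset [set~ i] :\ j.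
  apply/subsetP => x; rewrite !inE mnmDE oddD (msupp_sqr m2_z) addbF.
  rewrite mnmDE !mnmBE !mnm1E mnmE ![_ == x]eq_sym.
  case: (eqVneq x i) => [->|_]; first by rewrite eq_sym (negbTE li) (negbTE ij).
  by case: (eqVneq x j) => [->|_]; rewrite //= eq_sym (negbTE lj).
move=> /subset_leq_card le_odds.
have := card_setC1 i; rewrite (cardsD1 j) !inE eq_sym ij => <- /=.
by rewrite neq_ltn add1n ltnS le_odds.
Qed.

(** This is [hit_sum_nseq] at y = (X / (x_i x_j)) z^2. The terms with l = i and l = j
    are the two displayed ones; in every other term the variable x_l leaves the
    digit where x_i and x_j are already missing. *)
Lemma digits_swap c i j (z : P) : (0 < c)%N -> i != j ->
  digits (nseq c i) (digit j z) + digits (nseq c j) (digit i z) \in hitmod c.+1.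
Proof.
move=> c_gt0 ij; pose y : P := 'X_[all_vars - U_(i) - U_(j)] * z ^+ 2.
have opj : 'X_i * y = digit j z.
  rewrite digit.unlock mulrA -mpolyXD; congr ('X_[_] * _); apply/mnmP => l.
  rewrite mnmDE !mnmBE !mnm1E !mnmE ![_ == l]eq_sym.
  by case: (eqVneq l i) => [->|]; [rewrite (negbTE ij) | case: (l == j)].
have opi : 'X_j * y = digit i z.
  rewrite digit.unlock mulrA -mpolyXD; congr ('X_[_] * _); apply/mnmP => l.
  rewrite mnmDE !mnmBE !mnm1E !mnmE ![_ == l]eq_sym.
  case: (eqVneq l j) => [->|]; last by case: (l == i).
  by rewrite eq_sym (negbTE ij).
(* The summands other than i and j are the deficient ones. *)
have := hits_hitmod c.+1 (hit_sum_nseq y c_gt0).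
rewrite (bigD1 i) //= (bigD1 j) 1?eq_sym //= opi opj addrA.
rewrite rpredDr //; apply: rpred_sum => l /andP[li lj].
have := hitmod_digits (nseq c l) (mulX_deficient z ij li lj).
by rewrite size_nseq addn1.
Qed.

Lemma digits_congr d J (f g : P) : f + g \in hitmod d ->
  digits J f + digits J g \in hitmod (size J + d).
Proof. by rewrite -raddfD; apply: hitmod_digits. Qed.

Lemma hitmod_trans d (f g h : P) :
  f + g \in hitmod d -> g + h \in hitmod d -> f + h \in hitmod d.
Proof.
move=> fg gh; have := rpredD fg gh.
by rewrite -addrA (addrA g) mpolyDD add0r.
Qed.

Lemma digits_move J1 j J2 (y : P) :
  digits (J1 ++ j :: J2) y + digits (j :: J1 ++ J2) y \in hitmod (size J1 + size J2).+1.
Proof.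
elim: J1 => [|i J1 IH] /=; first by rewrite mpolyDD rpred0.
apply: (@hitmod_trans _ _ (digits [:: i; j] (digits (J1 ++ J2) y))).
  by apply: (digits_congr [:: i]) IH.
have [->|ij] := eqVneq i j; first by rewrite mpolyDD rpred0.
by apply: hitmod_le (digits_swap _ (isT : 0 < 1)%N ij).
Qed.

Lemma digits_perm J J' (y : P) :
  perm_eq J J' -> digits J y + digits J' y \in hitmod (size J).
Proof.
elim: J J' => [|j J IH] J' eqJ.
  by move: eqJ; rewrite perm_sym => /perm_nilP->; rewrite mpolyDD rpred0.
have jJ' : j \in J' by rewrite -(perm_mem eqJ) mem_head.
move: eqJ; case/splitPr: jJ' => J1 J2 eqJ.
have eqJ12 : perm_eq J (J1 ++ J2).
  by rewrite -(perm_cons j) (permPl eqJ) -cat_rcons -cats1 -catA perm_catCA.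
apply: (@hitmod_trans _ _ (digits (j :: J1 ++ J2) y)).
  exact: (digits_congr [:: j]) (IH _ eqJ12).
by rewrite addrC (perm_size eqJ) size_cat /= addnS digits_move.
Qed.

(** [digits_swap] for c = 1 permits permutations, so it suffices to exchange
    [i][i][j] with [j][j][i], which is [digits_swap] for c = 2. *)
Lemma digits_exchange i j J (y : P) : i \in J -> j \in J ->
  digits (i :: J) y + digits (j :: J) y \in hitmod (size J).+1.
Proof.
move=> iJ jJ; have [->|ij] := eqVneq i j; first by rewrite mpolyDD rpred0.
pose K := rem j (rem i J).
have permJ : perm_eq J [:: i, j & K].
  rewrite (permPl (perm_to_rem iJ)) perm_cons perm_to_rem //.
  have := perm_mem (perm_to_rem iJ) j.
  by rewrite jJ inE eq_sym (negbTE ij).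
have size_J := perm_size permJ.
apply: (@hitmod_trans _ _ (digits [:: i, i, j & K] y)).
  by apply: digits_perm; rewrite perm_cons.
apply: (@hitmod_trans _ _ (digits [:: j, j, i & K] y)).
  apply: hitmod_le (digits_swap (digits K y) (isT : 0 < 2)%N ij).
  by rewrite size_J.
rewrite addrC; apply: digits_perm; rewrite perm_cons (permPl permJ).
by rewrite -[[:: i, j & K]]/([:: i] ++ [:: j] ++ K) perm_catCA.
Qed.

Lemma has_dup (J : seq 'I_k) : ~~ uniq J -> exists j K, j \in K /\ perm_eq J (j :: K).
Proof.
elim: J => //= j J IH; rewrite negb_and negbK => /orP[jJ|/IH[i [K [iK eqJ]]]].
  by exists j, J.
exists i, (j :: K); rewrite inE iK orbT; split=> //.
rewrite -[j :: J]cat1s -[j :: K]cat1s -[i :: _]cat1s perm_sym perm_catCA perm_sym.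
by rewrite perm_cat2l.
Qed.

(** Permutations and exchanges of repeated entries connect any two sequences with
    the same size and the same elements: as a function of [J], [digits J y] is
    like a product of idempotent coordinates. *)
Lemma digits_eq_mem J J' (y : P) : size J = size J' -> J =i J' ->
  digits J y + digits J' y \in hitmod (size J).
Proof.
have [d] := ubnP (size J); elim: d J J' => // d IH J J' lt_d eq_sz eq_mem.
case/boolP: (uniq J) => uJ.
  apply: digits_perm; apply: uniq_perm => //.
  by rewrite (eq_uniq (s2 := J)) // => x; rewrite eq_mem.
have uJ' : ~~ uniq J'.
  by apply: contra uJ; rewrite (eq_uniq eq_sz eq_mem).
have [j [K [jK permJ]]] := has_dup uJ.
have [j' [K' [j'K' permJ']]] := has_dup uJ'.
have szJ := perm_size permJ; have szJ' := perm_size permJ'.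
have memJ x : (x \in J) = (x \in K).
  by rewrite (perm_mem permJ) inE; case: eqP => // ->; rewrite jK.
have memJ' x : (x \in J') = (x \in K').
  by rewrite (perm_mem permJ') inE; case: eqP => // ->; rewrite j'K'.
have eqK : K =i K' by move=> x; rewrite -memJ -memJ' eq_mem.
have szK : size K = size K' by apply/eqP; rewrite -eqSS -[_.+1]szJ eq_sz szJ'.
apply: (hitmod_trans (digits_perm y permJ)).
have permJ'' := digits_perm y permJ'; rewrite addrC -eq_sz in permJ''.
apply: hitmod_trans permJ''; rewrite szJ /=.
apply: (@hitmod_trans _ _ (digits (j' :: K) y)).
  by apply: digits_exchange; rewrite // eqK.
apply: (digits_congr [:: j']); apply: IH => //.
by move: lt_d; rewrite szJ.
Qed.

End Weights.

(** * Hit monomials in the degree of a spike *)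

Section Popcount.
Local Open Scope nat_scope.

Fixpoint popcount_rec (b n : nat) : nat :=
  if b is b'.+1 then odd n + popcount_rec b' n./2 else 0.

(** The number of binary digits 1, so the least number of powers of 2 with sum n.
    The fuel of [popcount_rec] is a bound on the number of digits. *)
Definition popcount (n : nat) : nat := popcount_rec n n.

Lemma popcount_rec_fuel b c n : n <= b -> n <= c ->
  popcount_rec b n = popcount_rec c n.
Proof.
have rec0 e : popcount_rec e 0 = 0 by elim: e.
elim: b c n => [|b IH] c n; first by rewrite leqn0 => /eqP->; rewrite !rec0.
case: c => [|c] le_b le_c.
  by move: le_c; rewrite leqn0 => /eqP->; rewrite !rec0.
by rewrite /= (IH c) //; lia.
Qed.

Lemma popcountE n : popcount n = odd n + popcount n./2.
Proof.
case: n => // n; rewrite /popcount /=; congr (_ + _).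
by apply: popcount_rec_fuel; lia.
Qed.

Lemma popcountS n : popcount n.+1 <= (popcount n).+1.
Proof.
elim/ltn_ind: n => n IH; rewrite popcountE [popcount n]popcountE /= uphalf_half.
case: (boolP (odd n)) => odd_n /=; last by rewrite add0n.
have lt_n : n./2 < n by lia.
by have := IH _ lt_n; rewrite !add1n; lia.
Qed.

Lemma popcount_addX a n : popcount (n + 2 ^ a) <= (popcount n).+1.
Proof.
elim: a n => [|a IH] n; first by rewrite addn1 popcountS.
rewrite popcountE [popcount n]popcountE expnS mul2n.
by rewrite oddD odd_double addbF halfD odd_double andbF doubleK add0n -addnS leq_add2l.
Qed.

Lemma popcount_sum (I : Type) (r : seq I) (P : pred I) (a : I -> nat) n :
  popcount (\sum_(i <- r | P i) 2 ^ a i + n) <= count P r + popcount n.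
Proof.
elim: r => [|i r IH]; first by rewrite big_nil.
rewrite big_cons /=; case: (P i) => //.
rewrite -addnA addnC; apply: leq_trans (popcount_addX _ _) _.
by rewrite -addnA add1n ltnS.
Qed.

Lemma popcount_addl a n : n < 2 ^ a -> popcount (2 ^ a + n) = (popcount n).+1.
Proof.
elim: a n => [|a IH] n; first by rewrite ltnS leqn0 => /eqP->.
rewrite expnS mul2n => lt_n; rewrite popcountE [popcount n]popcountE.
rewrite oddD odd_double halfD odd_double doubleK IH ?addnS //.
by lia.
Qed.

(** The minimal spikes are the monomials whose exponents are the 2^(c i) - 1, for
    such [c]. *)
Definition spike_exps (r : nat) (c : nat -> nat) : Prop :=
  [/\ forall i, 1 <= i <= r -> 0 < c i,
      forall i, 1 <= i < r.-1 -> c i.+1 < c i & c r <= c r.-1].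

(** Subtracting 1 replaces the last power of 2 by a nonempty run of digits 1 below
    all the other powers, which are distinct. *)
Lemma popcount_spike r c : 0 < r -> spike_exps r c ->
  r <= popcount (\sum_(1 <= i < r.+1) 2 ^ c i).-1.
Proof.
case: r => // r _ [c_gt0 c_decr c_last].
(* Add the powers from the smallest one upwards, keeping the partial sum
   below the next power. *)
pose V t := \sum_(r.+1 - t <= i < r.+1) 2 ^ c i + (2 ^ c r.+1).-1.
have c_r : 0 < 2 ^ c r.+1 by rewrite expn_gt0.
have VP t : t < r.+1 ->
    t < popcount (V t) /\ (t.+1 < r.+1 -> V t < 2 ^ c (r.+1 - t.+1)).
  elim: t => [|t IH] lt_t.
    rewrite /V subn0 big_geq // add0n; split.
      rewrite popcountE.
      have -> // : odd (2 ^ c r.+1).-1.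
      have := c_gt0 r.+1 (ltnSn _); case: (c r.+1) c_r => // e _ _.
      by rewrite -subn1 oddB ?expn_gt0 // oddX.
    move=> _; rewrite subn1 /= prednK //; rewrite leq_pexp2l //.
  have [|IH1 IH2] := IH; first by lia.
  have VS : V t.+1 = 2 ^ c (r.+1 - t.+1) + V t.
    rewrite /V big_ltn; last by lia.
    by rewrite -addnA; congr (_ + (_ + _)); apply: congr_big_nat => //; lia.
  have lt_V := IH2 lt_t.
  rewrite VS popcount_addl // ltnS; split=> // lt_t'.
  apply: leq_trans (_ : 2 ^ (c (r.+1 - t.+1)).+1 <= _).
    by rewrite expnS mul2n -addnn ltn_add2l.
  rewrite leq_pexp2l //; have := c_decr (r.+1 - t.+2).
  have -> : (r.+1 - t.+2).+1 = r.+1 - t.+1 by lia.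
  by apply; lia.
have [] := VP r (ltnSn _).
rewrite /V subSn // subnn => + _; congr (_ < popcount _).
by rewrite (big_nat_recr r.+1) //= -[in RHS](prednK c_r) addnS.
Qed.

Lemma spike_exps_min r c i : spike_exps r c -> 1 <= i <= r -> c r <= c i.
Proof.
move=> [_ c_decr c_last]; have [e] := ubnP (r - i); elim: e i => // e IH i lt_e i_r.
have [->//|i_neq_r] := eqVneq i r.
have [i_eq|i_neq] := eqVneq i r.-1; first by rewrite i_eq.
apply: leq_trans (IH i.+1 _ _) (ltnW (c_decr i _)); lia.
Qed.

Lemma spike_exps_shift r c t : spike_exps r c -> t < c r ->
  spike_exps r (fun i => c i - t).
Proof.
move=> c_spike lt_t; have c_min := spike_exps_min c_spike.
have [c_gt0 c_decr c_last] := c_spike.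
split=> [i i_r|i i_r|]; last exact: leq_sub2r.
  by have := c_min i i_r; lia.
by have := c_decr i i_r; have := c_min i; lia.
Qed.

(** The degree that remains after [t] lowest digits have been removed from a monomial
    of the degree of the spike, provided that these digits are full. *)
Definition spike_deg (r : nat) (c : nat -> nat) (t : nat) : nat :=
  \sum_(1 <= i < r.+1) (2 ^ (c i - t) - 1).

Lemma spike_degS r c t : spike_exps r c -> t < c r ->
  spike_deg r c t = r + (spike_deg r c t.+1).*2.
Proof.
move=> c_spike lt_t; rewrite /spike_deg -muln2 big_distrl /=.
rewrite -{2}[r]muln1 -{2}[r]subn0 -[(r - 0)%N]subSS -sum_nat_const_nat -big_split /=.
rewrite big_nat [RHS]big_nat; apply: eq_bigr => i i_r.
have := spike_exps_min c_spike i_r => c_i.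
have -> : c i - t = (c i - t.+1).+1 by lia.
by rewrite expnS; have := expn_gt0 2 (c i - t.+1); lia.
Qed.

End Popcount.

Section Degrees.
Variable k : nat.
Local Notation P := {mpoly 'F_2[k]}.

Lemma mnm_odd_half (m : 'X_{1..k}) :
  m = ([multinom (i \in odd_vars m : nat) | i < k] + half_mnm m *+ 2)%MM.
Proof.
apply/mnmP => i; rewrite mnmDE mulmnE !mnmE inE muln2.
by rewrite odd_double_half.
Qed.

Lemma mnm_digit (m : 'X_{1..k}) : (1 < k)%N -> #|odd_vars m| = k.-1 ->
  exists j, m = (all_but j + half_mnm m *+ 2)%MM.
Proof.
move=> k_gt1 odds_m; have /cards1P[j def_j] : #|~: odd_vars m| == 1%N.
  by have := cardsC (odd_vars m); rewrite card_ord odds_m; lia.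
exists j; rewrite {1}(mnm_odd_half m); congr (_ + _)%MM; apply/mnmP => i.
by rewrite !mnmE -[odd_vars m]setCK def_j !inE.
Qed.

Lemma mdeg_odd_half (m : 'X_{1..k}) :
  mdeg m = (#|odd_vars m| + (mdeg (half_mnm m)).*2)%N.
Proof.
rewrite {1}(mnm_odd_half m) mdegD mdegMn muln2; congr (_ + _)%N.
by apply: mdeg_set => i; rewrite mnmE.
Qed.

(** Wood's argument. Write the monomial as E z^2 with E squarefree. As z^2 = Sq^D z
    for D = deg z, it is E Sq^D z, and moving Sq^D onto E yields products of the
    x_i^(2^(a_i)), i in E, of degree deg E + D. If there are none, E z^2 is hit. *)
Lemma hit_odd_vars (m : 'X_{1..k}) :
  (forall a : 'I_k -> nat,
     (mdeg m + #|odd_vars m| != \sum_(i in odd_vars m) 2 ^ (a i).+1)%N) ->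
  'X_[m] \in @hits k.
Proof.
move=> not_sum; pose e : 'X_{1..k} := [multinom (i \in odd_vars m : nat) | i < k].
have eT i : e i = (i \in odd_vars m) by rewrite mnmE.
have span_e := pow2_span_set eT; have e_homog := dhomog_set eT.
have [f' [sf' f'_deg]] :=
  pow2_span_transfer (mdeg (half_mnm m)) 'X_[half_mnm m] span_e e_homog.
rewrite sq_deg mpolyXn -mpolyXD -mnm_odd_half.
suff -> : f' = 0 by rewrite mul0r subr0.
apply/eqP; rewrite -msupp_eq0; apply/negPn/negP => f'_neq0.
have /hasP[m1 m1_f' _] : has predT (msupp f') by rewrite has_predT lt0n size_eq0.
have [a def_m1] := pow2_span_supp sf' (enum_uniq _) m1_f'.
have := not_sum a; rewrite mdeg_odd_half; apply/negP; rewrite negbK; apply/eqP.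
have := dhomog_mf f'_deg m1_f'; rewrite /= (mdegE m1).
have -> : (\sum_i m1 i = \sum_(i in odd_vars m) 2 ^ a i)%N.
  rewrite [RHS]big_mkcond /=.
  by apply: eq_bigr => i _; rewrite def_m1 mem_enum.
move=> sum_a; under [RHS]eq_bigr do rewrite expnS.
by rewrite -big_distrr /= sum_a; lia.
Qed.

Lemma mdeg_odd (m : 'X_{1..k}) : odd (mdeg m) = odd #|odd_vars m|.
Proof. by rewrite mdeg_odd_half oddD odd_double addbF. Qed.

Lemma sum_predX (c : nat -> nat) r :
  (\sum_(1 <= i < r.+1) (2 ^ c i - 1) + r = \sum_(1 <= i < r.+1) 2 ^ c i)%N.
Proof.
rewrite -[X in (_ + X)%N](subnK (leq0n r)) subn0 addn0.
rewrite -[X in (_ + X)%N]muln1 -{2}[r]subn0 -[(r - 0)%N]subSS.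
rewrite -sum_nat_const_nat -big_split /=.
by apply: eq_bigr => i _; rewrite subnK // expn_gt0.
Qed.

(** With s odd exponents, parity gives s < k - 1. If Wood's argument failed, the
    degree plus s would be a sum of s powers of 2; adding k - 2 - s ones would
    write the sum of the 2^(c i), minus 1, with k - 2 powers of 2, against
    [popcount_spike]. *)
Lemma spike_deg_hit (c : nat -> nat) (m : 'X_{1..k}) : (1 < k)%N ->
  spike_exps k.-1 c -> mdeg m = (\sum_(1 <= i < k) (2 ^ c i - 1))%N ->
  #|odd_vars m| != k.-1 -> 'X_[m] \in @hits k.
Proof.
move=> k_gt1 c_spike deg_m odds_m; have [c_gt0 _ _] := c_spike.
have k_eq : k = k.-1.+1 by lia.
have sum_c := sum_predX c k.-1; rewrite -k_eq -deg_m in sum_c.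
have le_odds : (#|odd_vars m| <= k)%N by rewrite -[X in (_ <= X)%N]card_ord max_card.
have even_sum : odd (\sum_(1 <= i < k) 2 ^ c i) = false.
  rewrite big_nat; elim/big_rec: _ => // i x /andP[i_gt0 lt_ik] even_x.
  by rewrite oddD even_x oddX orbF; have := c_gt0 i; lia.
have lt_odds : (#|odd_vars m| < k.-1)%N.
  by have := mdeg_odd m; move: even_sum; rewrite -sum_c oddD; lia.
apply: hit_odd_vars => a; apply/negP => /eqP eq_sum.
have := popcount_spike _ c_spike; rewrite -k_eq -sum_c => le_pop.
have := popcount_sum (index_enum _) (mem (odd_vars m)) (fun i => (a i).+1) 0.
rewrite addn0.
have := popcount_sum (iota 0 (k.-2 - #|odd_vars m|)) predT (fun=> 0%N)
  (\sum_(i in odd_vars m) 2 ^ (a i).+1).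
rewrite count_predT size_iota -eq_sum big_const_seq count_predT size_iota.
rewrite iter_addn mul1n addn0.
have -> : (k.-2 - #|odd_vars m| + (mdeg m + #|odd_vars m|) = (mdeg m + k.-1).-1)%N by lia.
rewrite -sum1_count sum1_card addn0; have := le_pop _; lia.
Qed.

Lemma mem_hits_deg (r n : nat) (f : P) :
  (forall m, ~~ full_digits r m -> mdeg m = n -> 'X_[m] \in @hits k) ->
  f \in hitmod r -> f \is n.-homog -> f \in @hits k.
Proof.
move=> hitX f_mod /hcomp_id <-; elim/hitmod_ind: f_mod => [g h gP hP|g|m m_def].
- by rewrite hcompD rpredD.
- exact: hits_hcomp.
by rewrite hcompX; case: eqP => [/hitX->//|_]; exact: rpred0.
Qed.

(** Induction on the number of digits. If the lowest digit is full, the rest of the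
    monomial is hit by induction, and [hits_digit] leaves only monomials with a
    lowest digit that is not full; these are hit by [spike_deg_hit]. *)
Lemma hitmod_hits (c : nat -> nat) d t (f : P) : (1 < k)%N -> spike_exps k.-1 c ->
  (d + t <= c k.-1)%N -> f \is (spike_deg k.-1 c t).-homog ->
  f \in hitmod d -> f \in @hits k.
Proof.
move=> k_gt1 c_spike; have k_eq : k.-1.+1 = k by lia.
elim: d t f => [|d IH] t f le_d f_homog f_mod.
  by apply: mem_hits_deg f_mod f_homog.
have lt_t : (t < c k.-1)%N by lia.
have hit1 m : mdeg m = spike_deg k.-1 c t -> #|odd_vars m| != k.-1 -> 'X_[m] \in @hits k.
  rewrite /spike_deg k_eq; apply: spike_deg_hit => //.
  exact: spike_exps_shift.
apply: mem_hits_deg f_mod f_homog => m m_def deg_m.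
have [odds_m|/hit1] := eqVneq #|odd_vars m| k.-1; last exact.
move: m_def; rewrite /= odds_m eqxx /= => m_def.
have [j def_m] := mnm_digit k_gt1 odds_m.
have hit_half : 'X_[half_mnm m] \in @hits k.
  apply: (IH t.+1); [by lia| | exact: hitmodX].
  rewrite dhomogX; apply/eqP; rewrite /=; apply: double_inj.
  by move: (mdeg_odd_half m); rewrite deg_m (spike_degS c_spike lt_t) odds_m; lia.
have := hits_digit j hit_half; rewrite digitX -def_m => m_mod.
apply: (mem_hits_deg (n := spike_deg k.-1 c t) _ m_mod).
  by move=> m'; rewrite /= andbT => ? ?; apply: hit1.
by rewrite dhomogX; apply/eqP.
Qed.

End Degrees.

(** * Restriction to hyperplanes and Kameko's map *)

HB.lock Definition lsubst (k l : nat) (h : 'I_k -> {mpoly 'F_2[l]})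
  (f : {mpoly 'F_2[k]}) : {mpoly 'F_2[l]} := mmap (@mpolyC l 'F_2) h f.

(** Kameko's down map, which sends X y^2 to y and kills the monomials with an even
    exponent. The coefficients are read off at the exponents 2 m + (1, ..., 1). *)
HB.lock Definition kameko (k : nat) (f : {mpoly 'F_2[k]}) : {mpoly 'F_2[k]} :=
  \sum_(m : 'X_{1..k < msize f}) f@_(all_vars k + m *+ 2) *: 'X_[m].

Section LinearSubstitution.
Variables k l : nat.

(** The squares act on a sum of variables as they act on a variable. *)
Definition linear_form (u : {mpoly 'F_2[l]}) : Prop :=
  forall i, sq i u = if i == 0%N then u else if i == 1%N then u ^+ 2 else 0.

Lemma linear_formX j : linear_form 'X_j.
Proof. by move=> i; exact: sqX. Qed.

Lemma linear_form0 : linear_form 0.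
Proof. by move=> i; rewrite sqf0 expr2 mul0r !if_same. Qed.

Lemma linear_formD u v : linear_form u -> linear_form v -> linear_form (u + v).
Proof.
move=> lu lv i; rewrite sqD lu lv mpoly_sqrD.
by do 2?case: eqP => _; rewrite ?addr0.
Qed.

Lemma linear_form_sum (I : Type) (r : seq I) (P : pred I) F :
  (forall i, linear_form (F i)) -> linear_form (\sum_(i <- r | P i) F i).
Proof.
by move=> lF; elim/big_rec: _ => [|i x _]; [exact: linear_form0 | exact: linear_formD].
Qed.

Variable h : 'I_k -> {mpoly 'F_2[l]}.

Lemma lsubstD : {morph lsubst h : f g / f + g}.
Proof. by move=> f g; rewrite lsubst.unlock mmapD. Qed.

Lemma lsubst0 : lsubst h 0 = 0.
Proof. by rewrite lsubst.unlock mmap0. Qed.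

HB.instance Definition _ := GRing.isNmodMorphism.Build _ _ (lsubst h)
  (conj lsubst0 lsubstD).

Lemma lsubstM : {morph lsubst h : f g / f * g}.
Proof. by move=> f g; rewrite lsubst.unlock rmorphM. Qed.

Lemma lsubst1 : lsubst h 1 = 1.
Proof. by rewrite lsubst.unlock rmorph1. Qed.

Lemma lsubstX j : lsubst h 'X_j = h j.
Proof. by rewrite lsubst.unlock mmapX mmap1U. Qed.

Lemma lsubstXm m : lsubst h 'X_[m] = \prod_j h j ^+ m j.
Proof. by rewrite lsubst.unlock mmapX. Qed.

Lemma sq_lsubst i f : (forall j, linear_form (h j)) ->
  sq i (lsubst h f) = lsubst h (sq i f).
Proof.
move=> lh; elim/mpoly2_ind: f i => [|f g IHf IHg|m] i.
- by rewrite sqf0 lsubst0 sqf0.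
- by rewrite sqD !lsubstD sqD IHf IHg.
elim/mnm_ind: m i => [|j m IH] i.
  by rewrite mpolyX0 sq1 lsubst1 sq1; case: eqP; rewrite ?lsubst1 ?lsubst0.
rewrite mpolyXD lsubstM !sqM raddf_sum; apply: eq_bigr => a _ /=.
rewrite lsubstM IH lsubstX lh sqX; congr (_ * _).
by do 2?case: eqP => _; rewrite ?expr2 ?lsubstM ?lsubstX ?lsubst0.
Qed.

Lemma lsubst_hits f : (forall j, linear_form (h j)) ->
  f \in @hits k -> lsubst h f \in @hits l.
Proof.
move=> lh; elim/hits_ind => [|f1 g hf hg|i g i_gt0].
- by rewrite lsubst0 rpred0.
- by rewrite lsubstD rpredD.
by rewrite -sq_lsubst // sq_hit.
Qed.

Lemma lsubstX_homog m : (forall j, h j \is 1.-homog) ->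
  lsubst h 'X_[m] \is (mdeg m).-homog.
Proof.
move=> h1; elim/mnm_ind: m => [|j m IH].
  by rewrite mpolyX0 lsubst1 mdeg0; exact: dhomog1.
by rewrite mpolyXD lsubstM lsubstX mdegD mdeg1; exact: dhomogM (h1 j) IH.
Qed.

Lemma mpoly2E (f : {mpoly 'F_2[k]}) : f = \sum_(m <- msupp f) 'X_[m].
Proof.
rewrite {1}(mpolyE f) !big_seq; apply: eq_bigr => m; rewrite mcoeff_msupp.
by have /orP[/eqP->|/eqP->] := F2P f@_m; rewrite ?eqxx ?scale1r.
Qed.

Lemma lsubst_homog e f : (forall j, h j \is 1.-homog) ->
  f \is e.-homog -> lsubst h f \is e.-homog.
Proof.
move=> h1 /dhomog_mf f_e; rewrite (mpoly2E f) raddf_sum big_seq.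
by apply: rpred_sum => m mf; rewrite -(f_e _ mf) lsubstX_homog.
Qed.

End LinearSubstitution.

Section Kameko.
Variable k : nat.
Local Notation P := {mpoly 'F_2[k]}.

Lemma mcoeff_kameko (f : P) m : (kameko f)@_m = f@_(all_vars k + m *+ 2).
Proof.
rewrite kameko.unlock; case: (ltnP (mdeg m) (msize f)) => m_f.
  by rewrite (mcoeff_mpoly (fun m => f@_(all_vars k + m *+ 2))).
rewrite raddf_sum big1 /= => [|[m' m'_f] _ /=].
  apply/esym/memN_msupp_eq0/msize_mdeg_ge; apply: leq_trans m_f _.
  by rewrite mdegD mdegMn; lia.
rewrite mcoeffZ mcoeffX; case: eqP => [m_eq|]; last by rewrite mulr0.
by move: m_f; rewrite -m_eq leqNgt m'_f.
Qed.

Lemma kamekoD : {morph @kameko k : f g / f + g}.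
Proof. by move=> f g; apply/mpolyP => m; rewrite mcoeffD !mcoeff_kameko mcoeffD. Qed.

Lemma kameko0 : kameko 0 = 0 :> P.
Proof. by apply/mpolyP => m; rewrite mcoeff_kameko !mcoeff0. Qed.

HB.instance Definition _ := GRing.isNmodMorphism.Build _ _ (@kameko k)
  (conj kameko0 kamekoD).

Lemma kamekoX (m : 'X_{1..k}) :
  kameko 'X_[m] = if odd_vars m == setT then 'X_[half_mnm m] else 0 :> P.
Proof.
apply/mpolyP => n; rewrite mcoeff_kameko mcoeffX.
case: (odd_vars m =P setT) => odds_m; rewrite ?mcoeffX ?mcoeff0.
  have -> // : (m == all_vars k + n *+ 2)%MM = (half_mnm m == n).
  apply/eqP/eqP => [m_eq|<-].
    apply/mnmP => i; move/mnmP/(_ i): m_eq.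
    by rewrite mnmDE mulmnE mnmE mnmE => ->; lia.
  apply/mnmP => i; move/setP/(_ i): odds_m.
  by rewrite mnmDE mulmnE !mnmE !inE; lia.
case: eqP => // m_eq; case: odds_m; apply/setP => i.
by rewrite !inE m_eq mnmDE mulmnE mnmE; lia.
Qed.

Lemma kameko_eq0 (f : P) : (forall m, m \in msupp f -> odd_vars m != setT) -> kameko f = 0.
Proof.
move=> fP; apply/mpolyP => m; rewrite mcoeff_kameko mcoeff0.
apply/memN_msupp_eq0/negP => /fP/negP; apply; apply/eqP/setP => i.
by rewrite !inE mnmDE mulmnE mnmE; lia.
Qed.

Lemma kamekoM_sqr (f g : P) : kameko (f * g ^+ 2) = kameko f * g.
Proof.
elim/mpoly2_ind: g f => [|g h IHg IHh|n] f; first by rewrite expr2 !mul0r !mulr0 kameko0.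
  by rewrite mpoly_sqrD !mulrDr kamekoD IHg IHh.
elim/mpoly2_ind: f => [|f h IHf IHh|m]; first by rewrite !mul0r kameko0 mul0r.
  by rewrite mulrDl !kamekoD IHf IHh mulrDl.
have odds_mn : odd_vars (m + n *+ 2) = odd_vars m.
  by apply/setP => i; rewrite !inE mnmDE mulmnE; lia.
rewrite mpolyXn -mpolyXD !kamekoX odds_mn; case: ifP => _; last by rewrite mul0r.
rewrite -mpolyXD; congr 'X_[_]; apply/mnmP => i.
rewrite [LHS]mnmE [RHS]mnmDE mnmDE [half_mnm m i]mnmE mulmnE.
by lia.
Qed.

(** For E squarefree, Sq^i (E z^2) is the sum of the Sq^a E (Sq^c z)^2 with
    a + 2c = i. A positive square of E has no monomial with all exponents odd, so
    Kameko's map leaves at most Sq^(i/2) z. *)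
Lemma kameko_hits (f : P) : f \in @hits k -> kameko f \in @hits k.
Proof.
elim/hits_ind => [|g h gP hP|i g i_gt0]; first by rewrite kameko0 rpred0.
  by rewrite kamekoD rpredD.
elim/mpoly2_ind: g => [|g h gP hP|m]; first by rewrite sqf0 kameko0 rpred0.
  by rewrite sqD kamekoD rpredD.
pose e : 'X_{1..k} := [multinom (i \in odd_vars m : nat) | i < k].
have eT j : e j = (j \in odd_vars m) by rewrite mnmE.
have -> : 'X_[m] = 'X_[e] * 'X_[half_mnm m] ^+ 2 :> P.
  rewrite mpolyXn -mpolyXD; congr 'X_[_]; apply/mnmP => j.
  by rewrite mnmDE mulmnE !mnmE inE; lia.
rewrite sqM raddf_sum; apply: rpred_sum => a _ /=.
rewrite sq_sqr; case: ifP => odd_ia; first by rewrite mulr0 kameko0 rpred0.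
rewrite kamekoM_sqr; case: (posnP a) => [a0|a_gt0].
  rewrite a0 sq0 subn0 in odd_ia *.
  rewrite kamekoX; case: ifP => [/eqP odds_e|_]; last by rewrite mul0r rpred0.
  have -> : half_mnm e = 0%MM.
    by apply/mnmP => j; rewrite mnm0E mnmE eT; case: (_ \in _).
  by rewrite mpolyX0 mul1r sq_hit //; lia.
rewrite kameko_eq0 ?mul0r ?rpred0 // => m1 m1_sq.
apply/eqP => odds_m1.
have span_e := pow2_span_set eT; have e_homog := dhomog_set eT.
have [b def_m1] := pow2_span_supp (pow2_span_sq a span_e) (enum_uniq _) m1_sq.
have m1E j : m1 j = (j \in odd_vars m).
  rewrite def_m1 mem_enum; case: ifP => // j_m.
  have := in_setT j; rewrite -odds_m1 inE def_m1 mem_enum j_m oddX orbF.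
  by move/eqP->.
have := dhomog_mf (sq_homog a e_homog) m1_sq.
rewrite /= (mdeg_set m1E) => /eqP; rewrite -{1}[#|odd_vars m|]addn0 eqn_add2l.
by rewrite eq_sym eqn0Ngt a_gt0.
Qed.

Lemma kameko_homog e (f : P) : f \is (k + e.*2).-homog -> kameko f \is e.-homog.
Proof.
move=> f_homog; apply/dhomogP => m; rewrite mcoeff_msupp mcoeff_kameko.
rewrite -mcoeff_msupp => /(dhomog_mf f_homog) /=.
rewrite mdegD mdegMn.
have -> : mdeg (all_vars k) = k.
  by rewrite mdegE (eq_bigr (fun=> 1%N)) ?sum1_card ?card_ord // => i _; rewrite mnmE.
by rewrite /= => ?; lia.
Qed.

End Kameko.

Section Restriction.
Variable k : nat.
Local Notation P := {mpoly 'F_2[k.+1]}.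
Local Notation Q := {mpoly 'F_2[k]}.

(** The nonzero linear forms are the sums of variables over the nonempty sets [B]. *)
Definition lform (B : {set 'I_k.+1}) : P := \sum_(l in B) 'X_l.

Definition pivot (B : {set 'I_k.+1}) : 'I_k.+1 := odflt ord0 [pick i in B].

Definition drop_var (i j : 'I_k.+1) : Q :=
  if unlift i j is Some j' then 'X_j' else 0.

Definition restr_var (B : {set 'I_k.+1}) (j : 'I_k.+1) : Q :=
  drop_var (pivot B) j +
  (if j == pivot B then \sum_(l in B) drop_var (pivot B) l else 0).

(** The quotient of the polynomial ring by the linear form of [B], identified with a
    polynomial ring in one variable less by eliminating the variable [pivot B].
    The map [sect B] is the section that does not use this variable. *)
Definition restr (B : {set 'I_k.+1}) : P -> Q := lsubst (restr_var B).

Definition sect (B : {set 'I_k.+1}) : Q -> P :=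
  lsubst (fun j => 'X_(lift (pivot B) j)).

HB.instance Definition _ B := GRing.isNmodMorphism.Build _ _ (restr B)
  (conj (lsubst0 (restr_var B)) (lsubstD (restr_var B))).

HB.instance Definition _ B := GRing.isNmodMorphism.Build _ _ (sect B)
  (conj (lsubst0 (fun j => 'X_(lift (pivot B) j)))
        (lsubstD (fun j => 'X_(lift (pivot B) j)))).

Variable B : {set 'I_k.+1}.

Lemma drop_varE i j : drop_var i (lift i j) = 'X_j.
Proof. by rewrite /drop_var liftK. Qed.

Lemma drop_var_same i : drop_var i i = 0.
Proof. by rewrite /drop_var unlift_none. Qed.

Lemma restr_lift j : restr_var B (lift (pivot B) j) = 'X_j.
Proof. by rewrite /restr_var drop_varE eq_sym (negbTE (neq_lift _ _)) addr0. Qed.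

Lemma restr_pivot : restr_var B (pivot B) = \sum_(l in B) drop_var (pivot B) l.
Proof. by rewrite /restr_var drop_var_same eqxx add0r. Qed.

Lemma pivot_in : B != set0 -> pivot B \in B.
Proof.
case/set0Pn => i iB; rewrite /pivot; case: pickP => //= /(_ i).
by rewrite iB.
Qed.

Lemma drop_var_linear i j : linear_form (drop_var i j).
Proof.
rewrite /drop_var; case: unlift => [j'|]; first exact: linear_formX.
exact: linear_form0.
Qed.

Lemma restr_var_linear j : linear_form (restr_var B j).
Proof.
apply: linear_formD; first exact: drop_var_linear.
case: ifP => _; last exact: linear_form0.
by apply: linear_form_sum => l; exact: drop_var_linear.
Qed.

Lemma drop_var_homog i j : drop_var i j \is 1.-homog.
Proof.
rewrite /drop_var; case: unlift => [j'|]; last exact: rpred0.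
by rewrite dhomogX; apply/eqP; exact: mdeg1.
Qed.

Lemma restr_var_homog j : restr_var B j \is 1.-homog.
Proof.
apply: rpredD; first exact: drop_var_homog.
case: ifP => _; last exact: rpred0.
by apply: rpred_sum => l _; exact: drop_var_homog.
Qed.

Lemma sq_restr i f : sq i (restr B f) = restr B (sq i f).
Proof. exact: sq_lsubst restr_var_linear. Qed.

Lemma restr_hits f : f \in @hits k.+1 -> restr B f \in @hits k.
Proof. exact: lsubst_hits restr_var_linear. Qed.

Lemma restr_homog e f : f \is e.-homog -> restr B f \is e.-homog.
Proof. exact: lsubst_homog restr_var_homog. Qed.

Lemma restrM : {morph restr B : f g / f * g}.
Proof. exact: lsubstM. Qed.

Lemma restrX j : restr B 'X_j = restr_var B j.
Proof. exact: lsubstX. Qed.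

Lemma restr_sect f : restr B (sect B f) = f.
Proof.
rewrite /restr /sect; elim/mpoly2_ind: f => [|f g IHf IHg|m].
- by rewrite !lsubst0.
- by rewrite !lsubstD IHf IHg.
elim/mnm_ind: m => [|j m IH]; first by rewrite mpolyX0 !lsubst1.
by rewrite mpolyXD !lsubstM IH !lsubstX restr_lift.
Qed.

Lemma restr_lform : B != set0 -> restr B (lform B) = 0.
Proof.
move/pivot_in => pB; rewrite /lform raddf_sum /=.
under eq_bigr do rewrite restrX /restr_var.
rewrite big_split /= -big_mkcondr /= [X in _ + X](big_pred1 (pivot B)) ?mpolyDD // => j /=.
by rewrite andbC; case: eqP => // ->.
Qed.

Lemma sect_drop_var j : j != pivot B -> sect B (drop_var (pivot B) j) = 'X_j.
Proof.
move=> jp; rewrite /drop_var /sect; case: unliftP jp => [j' ->|->]; last by rewrite eqxx.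
by rewrite lsubstX.
Qed.

Lemma restr_split f : B != set0 -> exists q, f = sect B (restr B f) + lform B * q.
Proof.
move/pivot_in => pB.
elim/mpoly2_ind: f => [|f g [q IHf] [r IHg]|m].
- by exists 0; rewrite !raddf0 mulr0 addr0.
- by exists (q + r); rewrite {1}IHf {1}IHg !raddfD mulrDr addrACA.
elim/mnm_ind: m => [|j m [q IH]].
  by exists 0; rewrite mpolyX0 /restr /sect !lsubst1 mulr0 addr0.
have [r Xj] : exists r, 'X_j = sect B (restr B 'X_j) + lform B * r.
  rewrite restrX; have [->|jp] := eqVneq j (pivot B); last first.
    by exists 0; rewrite mulr0 addr0 /restr_var (negbTE jp) addr0 sect_drop_var.
  exists 1; rewrite restr_pivot mulr1 raddf_sum /lform /=.
  rewrite (bigD1 (pivot B)) //= drop_var_same raddf0 add0r.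
  rewrite [X in _ + X](bigD1 (pivot B)) //= addrCA.
  rewrite (eq_bigr (fun l => 'X_l)) ?mpolyDD ?addr0 // => l /andP[_ lp].
  by rewrite sect_drop_var.
have secM u v : sect B (restr B (u * v)) = sect B (restr B u) * sect B (restr B v).
  by rewrite restrM /sect lsubstM.
exists (sect B (restr B 'X_j) * q + r * 'X_[m]).
rewrite mpolyXD secM; move: Xj IH.
move: (sect B _) (sect B _) => a b -> ->; ring.
Qed.

(** The coefficient of the product of all variables in the restriction of X / x_j is a
    maximal minor of the restriction map, that is, the j-th coordinate of the
    linear form of [B]. *)
Lemma kameko_restr_all_but j : B != set0 ->
  kameko (restr B 'X_[all_but j]) = (j \in B)%:R.
Proof.
move=> /pivot_in pB; case: (unliftP (pivot B) j) => [j' ->|->].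
  have -> : 'X_[all_but (lift (pivot B) j')] = 'X_(pivot B) * sect B 'X_[all_but j'].
    rewrite /sect lsubstXm mpolyXE_id (bigD1_ord (pivot B)) //=.
    rewrite mnmE neq_lift expr1; congr (_ * _); apply: eq_bigr => i _.
    by rewrite !mnmE (inj_eq lift_inj).
  (* The pivot becomes the sum of the other variables of B, and among them only
     x_j completes the product of the remaining variables. *)
  rewrite restrM restr_sect restrX restr_pivot mulr_suml raddf_sum /=.
  under eq_bigr => l lB.
    have -> : kameko (drop_var (pivot B) l * 'X_[all_but j']) =
              if l == lift (pivot B) j' then 1 else 0.
      case: (unliftP (pivot B) l) => [l' ->|->]; last first.
        by rewrite drop_var_same mul0r kameko0 (negbTE (neq_lift _ _)).
      rewrite drop_varE -mpolyXD kamekoX (inj_eq lift_inj).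
      case: eqP => [odds_eq|odds_neq]; last first.
        case: eqP => // l'j'; case: odds_neq; rewrite l'j' all_butD.
        by apply/setP => i; rewrite !inE mnmE.
      case: eqP => [->|/eqP l'j']; last first.
        have := in_setT l'; rewrite -odds_eq inE mnmDE mnm1E mnmE eqxx.
        by rewrite l'j'.
      have -> : half_mnm (U_(j') + all_but j') = 0%MM.
        by rewrite all_butD; apply/mnmP => i; rewrite !mnmE.
      by rewrite mpolyX0.
    over.
  rewrite -big_mkcondr /=; case: (boolP (_ \in B)) => jB.
    rewrite (big_pred1 (lift (pivot B) j')) // => i /=.
    by rewrite andbC; case: eqP => // ->.
  rewrite big1 // => i /andP[iB /eqP i_eq]; by rewrite -i_eq iB in jB.
have -> : 'X_[all_but (pivot B)] = sect B 'X_[all_vars k].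
  rewrite /sect lsubstXm mpolyXE_id (bigD1_ord (pivot B)) //=.
  rewrite mnmE eqxx expr0 mul1r; apply: eq_bigr => i _.
  by rewrite !mnmE eq_sym neq_lift.
rewrite restr_sect kamekoX pB.
have -> : odd_vars (all_vars k) == setT by apply/eqP/setP => i; rewrite !inE mnmE.
have -> : half_mnm (all_vars k) = 0%MM by apply/mnmP => i; rewrite !mnmE.
by rewrite mpolyX0.
Qed.

(** Restrict to the hyperplane of [B], then remove [d] full digits. On [digits J y] this
    gives the value at [B] of the monomial in the coordinate functions indexed by
    [J], times the restriction of [y] ([Phi_digits]). *)
Definition Phi (d : nat) (f : P) : Q := iter d (@kameko k) (restr B f).

Lemma iter_kameko_is_additive d :
  (iter d (@kameko k) 0 = 0) * {morph iter d (@kameko k) : f g / f + g}.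
Proof.
elim: d => [|d [IH0 IHD]]; first by split.
by split => [|f g]; rewrite !iterS ?IH0 ?kameko0 // IHD kamekoD.
Qed.

Lemma PhiD d : {morph Phi d : f g / f + g}.
Proof. by move=> f g; rewrite /Phi raddfD (iter_kameko_is_additive d).2. Qed.

Lemma Phi0 d : Phi d 0 = 0.
Proof. by rewrite /Phi raddf0 (iter_kameko_is_additive d).1. Qed.

HB.instance Definition _ d := GRing.isNmodMorphism.Build _ _ (Phi d)
  (conj (Phi0 d) (PhiD d)).

Lemma Phi_hits d f : f \in @hits k.+1 -> Phi d f \in @hits k.
Proof.
by move=> hf; rewrite /Phi; elim: d => [|d IH]; [exact: restr_hits | exact: kameko_hits].
Qed.

Lemma Phi_digits J f : B != set0 ->
  Phi (size J) (digits J f) = if all (mem B) J then restr B f else 0.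
Proof.
move=> B0; elim: J => // j J IH; rewrite digits_cons digit.unlock /Phi iterSr.
rewrite restrM expr2 restrM -expr2 kamekoM_sqr kameko_restr_all_but //=.
case: (j \in B); first by rewrite mul1r.
by rewrite mul0r (iter_kameko_is_additive _).1.
Qed.

End Restriction.

(** * Families of polynomials indexed by linear forms *)

Section Families.
Variables (k d : nat).
Hypotheses (k_gt0 : (0 < k)%N) (le_kd : (k <= d)%N).
Local Notation P := {mpoly 'F_2[k.+1]}.
Local Notation Q := {mpoly 'F_2[k]}.
Local Notation fam := {ffun {set 'I_k.+1} -> P}.

Implicit Types (S T A B C : {set 'I_k.+1}) (Y Z : fam).

(** There are 2^n sets between S and T, where n is the size of T minus S, and the
    characteristic is 2. *)
Lemma sum_interval (S T : {set 'I_k.+1}) (y : P) :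
  \sum_(A : {set 'I_k.+1} | (S \subset A) && (A \subset T)) y = if S == T then y else 0.
Proof.
case: (eqVneq S T) => [<-|ST].
  by rewrite (big_pred1 S) // => A /=; rewrite eqEsubset andbC.
case: (boolP (S \subset T)) => [sST|nST]; last first.
  by rewrite big1 // => A /andP[SA AT]; case/negP: nST; apply: subset_trans AT.
have /set0Pn[i] : T :\: S != set0.
  by rewrite setD_eq0; apply: contra ST => sTS; rewrite eqEsubset sST.
rewrite inE => /andP[iS iT].
rewrite (bigID (fun A : {set _} => i \in A)) /=.
rewrite (reindex_onto (fun A => i |: A) (fun A => A :\ i)) /=; last first.
  by move=> A /andP[_ iA]; rewrite setD1K.
rewrite [X in X + _](eq_bigl
  (fun A : {set _} => (S \subset A) && (A \subset T) && (i \notin A))) ?mpolyDD //.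
move=> A; rewrite setU11 andbT subUset sub1set iT /=.
have -> : ((i |: A) :\ i == A) = (i \notin A).
  apply/eqP/idP => [<-|iA]; first by rewrite setD11.
  by rewrite setU1K.
case: (boolP (i \in A)) => iA; rewrite ?andbF //= !andbT; congr (_ && _).
apply/subsetP/subsetP => sub x xS; have := sub x xS; rewrite ?inE.
  by case/orP => // /eqP x_i; rewrite -x_i xS in iS.
by move=> ->; rewrite orbT.
Qed.

(** A sequence of size [d] with set of elements [S], for S nonempty of size at most
    [d]. By [digits_eq_mem] any other one gives the same [digits J y] modulo
    [hitmod d]. *)
Definition spread (S : {set 'I_k.+1}) : seq 'I_k.+1 :=
  enum S ++ nseq (d - #|S|) (pivot S).

Lemma size_spread S : (#|S| <= d)%N -> size (spread S) = d.
Proof. by move=> le_Sd; rewrite size_cat size_nseq -cardE subnKC. Qed.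

Lemma mem_spread S : S != set0 -> spread S =i S.
Proof.
move=> /pivot_in pS i; rewrite mem_cat mem_enum mem_nseq.
case: (boolP (i \in S)) => //= iS; apply/negP => /andP[_ /eqP i_p].
by rewrite i_p pS in iS.
Qed.

Lemma leq_card_spread S : S != setT -> (#|S| <= d)%N.
Proof.
move=> ST; apply: leq_trans le_kd; rewrite -ltnS -[X in (_ < X)%N]card_ord -cardsT.
by rewrite proper_card // properT.
Qed.

Lemma digits_spread J S (y : P) : size J = d -> J =i S ->
  digits J y + digits (spread S) y \in hitmod d.
Proof.
move=> szJ memJ.
have S_neq0 : S != set0.
  apply/set0Pn; case: J szJ memJ => [d0|i J _ memJ]; last first.
    by exists i; rewrite -memJ mem_head.
  by move: le_kd; rewrite -d0 leqNgt k_gt0.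
have leSd : (#|S| <= d)%N.
  by rewrite -szJ -(eq_card memJ) card_size.
rewrite -[X in hitmod X]szJ; apply: digits_eq_mem; first by rewrite size_spread.
by move=> i; rewrite mem_spread.
Qed.

(** [hit_sum_nseq] with the elements of [S] as first digits, padded by l up to [d]
    digits: the sum over l of u_S u_l (x) x_l z vanishes, where u_S is the product
    of the coordinate functions of [S]. *)
Lemma spread_sum S (z : P) : (#|S| < d)%N ->
  \sum_l digits (spread (l |: S)) ('X_l * z) \in hitmod d.
Proof.
move=> lt_Sd; pose c := (d - #|S|)%N.
have hit_sum : \sum_l digits (enum S ++ nseq c l) ('X_l * z) \in hitmod d.
  have c_gt0 : (0 < c)%N by rewrite subn_gt0.
  under eq_bigr do rewrite digits_cat.
  rewrite -raddf_sum /=; apply: hitmod_le (hits_digits _ (hit_sum_nseq z c_gt0)).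
  by rewrite -cardE ltnW.
rewrite -(rpredDl _ hit_sum) -big_split /=; apply: rpred_sum => l _.
apply: digits_spread; first by rewrite size_cat size_nseq -cardE subnKC // ltnW.
move=> i; rewrite mem_cat mem_enum mem_nseq !inE subn_gt0 lt_Sd /= orbC.
by [].
Qed.

(** Passage from the values of a function of the linear form to its coefficients in
    the basis of the products u_S of coordinate functions. It is an involution. *)
Definition zeta (Y : fam) (S : {set 'I_k.+1}) : P := \sum_(A : {set _} | A \subset S) Y A.

(** The polynomial whose images under the maps [Phi] are the restrictions of the
    members of [Y] ([Phi_Psi]): expand [Y] in the products u_S and replace
    u_S (x) y by [digits (spread S) y]. *)
Definition Psi (Y : fam) : P := \sum_S digits (spread S) (zeta Y S).

(** No constant term, and no term of degree k + 1, in the products of coordinate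
    functions: [spread] represents neither the empty set nor, if d = k, the full
    one. *)
Definition balanced (Y : fam) : Prop := Y set0 = 0 /\ \sum_A Y A = 0.

Lemma zetaD Y Z S : zeta (Y + Z) S = zeta Y S + zeta Z S.
Proof. by rewrite -big_split; apply: eq_bigr => A _; rewrite ffunE. Qed.

Lemma PsiD : {morph Psi : Y Z / Y + Z}.
Proof.
by move=> Y Z; rewrite -big_split; apply: eq_bigr => S _; rewrite zetaD digitsD.
Qed.

Lemma Psi0 : Psi 0 = 0.
Proof.
rewrite /Psi big1 // => S _; rewrite /zeta big1 ?digits0 // => A _.
by rewrite ffunE.
Qed.

HB.instance Definition _ := GRing.isNmodMorphism.Build _ _ Psi (conj Psi0 PsiD).

Lemma balancedD Y Z : balanced Y -> balanced Z -> balanced (Y + Z).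
Proof.
move=> [Y0 YT] [Z0 ZT]; split; first by rewrite ffunE Y0 Z0 addr0.
by under eq_bigr do rewrite ffunE; rewrite big_split /= YT ZT addr0.
Qed.

Lemma balanced0 : balanced 0.
Proof. by split; [rewrite ffunE | rewrite big1 // => A _; rewrite ffunE]. Qed.

Lemma balanced_sum (I : Type) (r : seq I) (p : pred I) (F : I -> fam) :
  (forall i, p i -> balanced (F i)) -> balanced (\sum_(i <- r | p i) F i).
Proof. by move=> vF; elim/big_ind: _ => //; [exact: balanced0 | exact: balancedD]. Qed.

Lemma balanced_zeta Y S : balanced Y -> (S == set0) || (S == setT) -> zeta Y S = 0.
Proof.
move=> [Y0 YT] /orP[]/eqP->.
  by rewrite /zeta (big_pred1 set0) // => A /=; rewrite subset0.
by rewrite /zeta -[RHS]YT; apply: eq_bigl => A; rewrite subsetT.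
Qed.

Lemma Psi_hits Y : balanced Y -> (forall A, Y A \in @hits k.+1) -> Psi Y \in hitmod d.
Proof.
move=> vY hY; apply: rpred_sum => S _.
case: (boolP ((S == set0) || (S == setT))) => [S0T|].
  by rewrite balanced_zeta // digits0 rpred0.
rewrite negb_or => /andP[S0 ST].
have := hits_digits (spread S) (rpred_sum _ (fun A _ => hY A) : zeta Y S \in _).
by rewrite size_spread // leq_card_spread.
Qed.

Lemma digitsZ J (c : 'F_2) (f : P) : digits J (c *: f) = c *: digits J f.
Proof. by have /orP[/eqP->|/eqP->] := F2P c; rewrite ?scale0r ?scale1r ?digits0. Qed.

(** The universal linear form, whose value at [A] is [lform A], times f and z. *)
Definition weighted (f : {set 'I_k.+1} -> 'F_2) (z : P) : fam :=
  [ffun A => f A *: (lform A * z)].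

(** The coefficient of the universal linear form at u_l is x_l, so the expansion of
    [weighted f z] is a combination of the sums in [spread_sum]. That lemma
    applies to the products of degree less than [d], hence the bound on the
    degree of [f]. *)
Lemma Psi_weighted (f : {set 'I_k.+1} -> 'F_2) (z : P) :
  (forall S : {set 'I_k.+1}, (k <= #|S|)%N -> \sum_(A : {set _} | A \subset S) f A = 0) ->
  Psi (weighted f z) \in hitmod d.
Proof.
pose zf (S : {set 'I_k.+1}) : 'F_2 := \sum_(A : {set _} | A \subset S) f A.
move=> f_low; have zf0 S : (k <= #|S|)%N -> zf S = 0 by apply: f_low.
suff -> : Psi (weighted f z) = \sum_S zf S *: \sum_l digits (spread (l |: S)) ('X_l * z).
  apply: rpred_sum => S _; case: (ltnP #|S| k) => Sk.
    by rewrite rpredZ // spread_sum // (leq_trans Sk).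
  by rewrite zf0 // scale0r rpred0.
pose g l T := digits (spread T) ('X_l * z).
transitivity (\sum_(T : {set 'I_k.+1}) \sum_(l in T) (zf T + zf (T :\ l)) *: g l T).
  apply: eq_bigr => T _.
  have -> : zeta (weighted f z) T = \sum_(l in T) (zf T + zf (T :\ l)) *: ('X_l * z).
    rewrite /zeta; under eq_bigr do rewrite ffunE mulr_suml scaler_sumr.
    rewrite (exchange_big_dep (mem T)) /=; last first.
      by move=> A l /subsetP; apply.
    apply: eq_bigr => l lT; rewrite -scaler_suml; congr (_ *: _).
    rewrite /zf [X in _ = X + _](bigID (fun A : {set _} => l \in A)) /=.
    rewrite -addrA -[LHS]addr0; congr (_ + _).
    rewrite [X in _ = _ + X](eq_bigl
      (fun A : {set _} => (A \subset T) && (l \notin A))).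
      by rewrite -mulr2n -mulr_natr natr2_F2 mulr0.
    by move=> A; rewrite subsetD1.
  by rewrite raddf_sum /=; apply: eq_bigr => l _; rewrite digitsZ.
under [RHS]eq_bigr do rewrite scaler_sumr.
rewrite [RHS]exchange_big /= (exchange_big_dep predT) //=.
apply: eq_bigr => l _; rewrite [RHS](bigID (fun S : {set _} => l \in S)) /=.
under eq_bigr do rewrite scalerDl.
rewrite big_split /=; congr (_ + _).
  by apply: eq_bigr => S lS; rewrite (setUidPr _) // sub1set.
rewrite (reindex_onto (fun A => l |: A) (fun A => A :\ l)) /=; last first.
  by move=> A lA; rewrite setD1K.
apply: eq_big => [A|A /andP[_ /eqP ->] //].
rewrite setU11 /=; apply/eqP/idP => [<-|lA]; first by rewrite setD11.
by rewrite setU1K.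
Qed.

Definition single (A : {set 'I_k.+1}) (y : P) : fam := [ffun B => if B == A then y else 0].

(** A family with sum 0 whose members are multiples of their linear forms; it serves to
    move such multiples to single variables. *)
Definition star (A : {set 'I_k.+1}) (z : P) : fam :=
  single A (lform A * z) + \sum_(i in A) single [set i] ('X_i * z).

Lemma singleD A : {morph single A : y z / y + z}.
Proof. by move=> y z; apply/ffunP => B; rewrite !ffunE; case: ifP; rewrite ?addr0. Qed.

Lemma single0 A : single A 0 = 0.
Proof. by apply/ffunP => B; rewrite !ffunE if_same. Qed.

HB.instance Definition _ A := GRing.isNmodMorphism.Build _ _ (single A)
  (conj (single0 A) (singleD A)).

Lemma lform1 i : lform [set i] = 'X_i :> P.
Proof. by rewrite /lform big_set1. Qed.

Lemma lform0 : lform set0 = 0 :> P.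
Proof. by rewrite /lform big_set0. Qed.

(** The value at the empty set, where the linear form is 0, is free; it is chosen so
    that the products u_S with S of size k and k + 1 do not occur. *)
Definition star_weight (A B : {set 'I_k.+1}) : 'F_2 :=
  (B == A)%:R + \sum_(i in A) (B == [set i])%:R + (B == set0)%:R * (#|A|.+1)%:R.

Lemma starE A z : star A z = weighted (star_weight A) z.
Proof.
apply/ffunP => B; rewrite !ffunE sum_ffunE /star_weight.
have [->|B0] := eqVneq B set0.
  rewrite lform0 !mul0r scaler0; case: eqP => [<-|_]; last first.
    rewrite add0r big1 // => i _; rewrite ffunE; case: eqP => // /esym/eqP.
    by rewrite -cards_eq0 cards1.
  by rewrite lform0 mul0r big_set0 addr0.
rewrite mul0r addr0 scalerDl; congr (_ + _).
  by case: eqP => [->|_]; rewrite ?scale1r ?scale0r.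
rewrite scaler_suml; apply: eq_bigr => i _; rewrite ffunE.
by case: eqP => [->|_]; rewrite ?lform1 ?scale1r ?scale0r.
Qed.

Lemma natr_F2 n : n%:R = (odd n)%:R :> 'F_2.
Proof.
rewrite -{1}[n]odd_double_half natrD -muln2 natrM natr2_F2 mulr0 addr0.
by [].
Qed.

Lemma Psi_star A z : Psi (star A z) \in hitmod d.
Proof.
rewrite starE; apply: Psi_weighted => S le_kS; rewrite /star_weight.
rewrite !big_split /= exchange_big /=.
have sum_eq (C : {set 'I_k.+1}) :
    \sum_(B : {set _} | B \subset S) (B == C)%:R = (C \subset S)%:R :> 'F_2.
  case: (boolP (C \subset S)) => CS.
    by rewrite (bigD1 C) //= eqxx big1 ?addr0 // => B /andP[_ /negbTE->].
  rewrite big1 // => B BS; case: eqP => // B_C.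
  by rewrite -B_C BS in CS.
rewrite sum_eq -mulr_suml sum_eq sub0set mul1r.
under [X in _ + X + _]eq_bigr do rewrite sum_eq sub1set.
rewrite -natr_sum -!natrD natr_F2.
have -> : (\sum_(i in A) (i \in S) = #|A :&: S|)%N.
  rewrite -sum1_card -big_mkcondr /=.
  by apply: eq_bigl => i; rewrite inE.
have cardA := cardsID S A.
have le1 : (#|A :\: S| <= 1)%N.
  apply: leq_trans (_ : #|~: S| <= 1)%N.
    by apply/subset_leq_card/subsetP => i; rewrite !inE => /andP[].
  by have := cardsC S; rewrite card_ord; lia.
have subA : (A \subset S) = (#|A :\: S| == 0)%N by rewrite cards_eq0 setD_eq0.
rewrite subA -cardA (_ : odd _ = false) //.
by case: #|A :\: S| le1 => [|[|//]] _ /=; rewrite !oddD /= ?oddD; case: (odd _).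
Qed.

Definition sqfam i Y : fam := [ffun A => sq i (Y A)].

Lemma balanced_sqfam i Y : balanced Y -> balanced (sqfam i Y).
Proof.
move=> [Y0 YT]; split; first by rewrite ffunE Y0 sqf0.
by under eq_bigr do rewrite ffunE; rewrite -raddf_sum YT raddf0.
Qed.

Lemma sum_single A (y : P) : \sum_B single A y B = y.
Proof.
rewrite (bigD1 A) //= ffunE eqxx big1 ?addr0 // => B /negbTE BA.
by rewrite ffunE BA.
Qed.

Lemma balanced_star A z : balanced (star A z).
Proof.
split.
  rewrite starE ffunE lform0 mul0r scaler0 //.
under eq_bigr do rewrite ffunE sum_ffunE; rewrite big_split /= sum_single.
rewrite exchange_big /=; under [X in _ + X]eq_bigr do rewrite sum_single.
by rewrite -mulr_suml mpolyDD.
Qed.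

(** With x_A = x_i + x_j, apply Sq^1 to the family of the x_B z, B in {A, i, j}: the
    result, of values x_B^2 z + x_B Sq^1 z, is made of hits. Adding the family of
    the x_B (x_A z + Sq^1 z) leaves x_B (x_B + x_A) z, which is 0 at A and
    x_i x_j z at i and at j. *)
Lemma Psi_koszul i j (z : P) :
  Psi (single [set i] ('X_i * ('X_j * z)) + single [set j] ('X_i * ('X_j * z)))
    \in hitmod d.
Proof.
have [->|ij] := eqVneq i j; first by rewrite -raddfD mpolyDD raddf0 raddf0 rpred0.
pose A := [set i; j].
have A_i : [set i] != A.
  by apply: contra ij => /eqP/setP/(_ j); rewrite !inE eqxx orbT eq_sym.
have A_j : [set j] != A.
  by apply: contra ij => /eqP/setP/(_ i); rewrite !inE eqxx.
have sum_A (u : 'I_k.+1 -> fam) : \sum_(l in A) u l = u i + u j.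
  by rewrite /A big_setU1 ?big_set1 // inE.
have lformA : lform A = 'X_i + 'X_j :> P.
  by rewrite /lform /A big_setU1 ?big_set1 // inE.
have -> : single [set i] ('X_i * ('X_j * z)) + single [set j] ('X_i * ('X_j * z)) =
    sqfam 1 (star A z) + star A (lform A * z + sq 1 z).
  have sq1M (u v : P) : linear_form u -> sq 1 (u * v) = u ^+ 2 * v + u * sq 1 v.
    by move=> lu; rewrite sqM big_ord_recl big_ord1 /= !lu sq0 addrC.
  have sq_single B (y : P) : sqfam 1 (single B y) = single B (sq 1 y).
    by apply/ffunP => C; rewrite !ffunE; case: ifP; rewrite ?sqf0.
  have sqfamD Y Z : sqfam 1 (Y + Z) = sqfam 1 Y + sqfam 1 Z.
    by apply/ffunP => C; rewrite !ffunE sqD.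
  rewrite /star !sum_A !sqfamD !sq_single addrACA -raddfD [in RHS]addrACA -!raddfD /=.
  have lX l : linear_form ('X_l : P) by exact: linear_formX.
  rewrite !sq1M // ?lformA; last exact: linear_formD.
  have char2 (u v : P) : u = v + v -> u = 0 by move=> ->; rewrite mpolyDD.
  pose v : P := ('X_i + 'X_j) ^+ 2 * z + ('X_i + 'X_j) * sq 1 z.
  rewrite [X in single A X](char2 _ v) /v ?raddf0 ?add0r; last by ring.
  congr (single _ _ + single _ _).
    apply/eqP; rewrite -subr_eq0 mpolyN; apply/eqP.
    by apply: (char2 _ ('X_i ^+ 2 * z + 'X_i * sq 1 z + 'X_i * ('X_j * z))); ring.
  apply/eqP; rewrite -subr_eq0 mpolyN; apply/eqP.
  by apply: (char2 _ ('X_j ^+ 2 * z + 'X_j * sq 1 z + 'X_i * ('X_j * z))); ring.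
rewrite raddfD /= rpredD ?Psi_star //; apply: Psi_hits.
  exact/balanced_sqfam/balanced_star.
by move=> B; rewrite ffunE sq_hit.
Qed.

(** For each monomial m, an even number of the [y i] contain it, and all these x_i
    divide m. Comparing them with one fixed index decomposes the family into the
    pairs of [Psi_koszul]. *)
Lemma Psi_singles (y : 'I_k.+1 -> P) :
  (forall i m, m \in msupp (y i) -> m i != 0%N) -> \sum_i y i = 0 ->
  Psi (\sum_i single [set i] (y i)) \in hitmod d.
Proof.
move=> y_div y_sum; pose N := (\max_i msize (y i))%N.
have yE i : y i = \sum_(m : 'X_{1..k.+1 < N}) (y i)@_m *: 'X_[m].
  by apply: mpolywE; apply: leq_bigmax.
under eq_bigr => i _ do rewrite yE raddf_sum.
rewrite exchange_big raddf_sum; apply: rpred_sum => m _ /=.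
have [c0|[i0 ci0]] : (forall i, (y i)@_m = 0) \/ exists i, (y i)@_m != 0.
  case: (boolP [exists i, (y i)@_m != 0]) => [/existsP|]; first by right.
  rewrite negb_exists => /forallP c0; left=> i.
  by apply/eqP; have := c0 i; rewrite negbK.
  rewrite big1 ?raddf0 ?rpred0 // => i _.
  by rewrite c0 scale0r raddf0.
have mi0 : (m : 'X_{1..k.+1}) i0 != 0%N.
  by apply: (y_div i0); rewrite mcoeff_msupp.
have c_sum : \sum_i (y i)@_m = 0.
  by rewrite -[RHS](mcoeff0 _ m) -y_sum raddf_sum.
have singleZ A (c : 'F_2) (u : P) : single A (c *: u) = c *: single A u.
  by apply/ffunP => B; rewrite !ffunE; case: ifP; rewrite ?scaler0.
have PsiZ (c : 'F_2) Y : Psi (c *: Y) = c *: Psi Y.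
  by have /orP[/eqP->|/eqP->] := F2P c; rewrite ?scale0r ?scale1r ?Psi0.
have -> : \sum_i single [set i] ((y i)@_m *: 'X_[m]) =
    \sum_i (y i)@_m *: (single [set i] 'X_[m] + single [set i0] 'X_[m]).
  under [RHS]eq_bigr do rewrite scalerDr.
  rewrite big_split /= -scaler_suml c_sum scale0r addr0.
  by apply: eq_bigr => i _; rewrite singleZ.
rewrite raddf_sum; apply: rpred_sum => i _ /=; rewrite PsiZ.
have [->|ci] := eqVneq (y i)@_m 0; first by rewrite scale0r rpred0.
rewrite rpredZ //; have mi : (m : 'X_{1..k.+1}) i != 0%N.
  by apply: (y_div i); rewrite mcoeff_msupp.
have [->|i_i0] := eqVneq i i0.
  by rewrite -raddfD /= mpolyDD !raddf0 rpred0.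
have -> : 'X_[m] = 'X_i * ('X_i0 * 'X_[m - U_(i) - U_(i0)]) :> P.
  rewrite -!mpolyXD; congr 'X_[_]; apply/mnmP => x.
  rewrite !mnmDE !mnmBE !mnm1E.
  have [x_i|_] := eqVneq i x; have [x_i0|_] := eqVneq i0 x.
  - by rewrite x_i x_i0 eqxx in i_i0.
  - rewrite -x_i /=; move: mi; lia.
  - rewrite -x_i0 /=; move: mi0; lia.
  by rewrite !subn0.
exact: Psi_koszul.
Qed.

(** The families [star] move all the multiples of linear forms to the singletons. *)
Lemma Psi_lform Y (q : {set 'I_k.+1} -> P) :
  (forall A, Y A = lform A * q A) -> \sum_A Y A = 0 -> Psi Y \in hitmod d.
Proof.
move=> YE Y_sum; pose r i := \sum_(A : {set 'I_k.+1} | i \in A) q A.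
have Y_single : Y = \sum_A single A (lform A * q A).
  apply/ffunP => B; rewrite sum_ffunE (bigD1 B) //= ffunE eqxx big1 ?addr0 ?YE //.
  by move=> A; rewrite ffunE eq_sym => /negbTE->.
have Y_split : Y = \sum_A star A (q A) + \sum_i single [set i] ('X_i * r i).
  rewrite /star big_split /= -Y_single -addrA -[LHS]addr0; congr (_ + _).
  rewrite (exchange_big_dep predT) //= -big_split big1 //= => i _.
  by rewrite -raddf_sum -mulr_sumr -raddfD /= mpolyDD raddf0.
rewrite Y_split raddfD /=; apply: rpredD.
  by rewrite raddf_sum; apply: rpred_sum => A _; exact: Psi_star.
apply: Psi_singles => [i m|].
  rewrite mulrC => /msuppM_le /allpairsP[[m1 m2] /= [_]].
  by rewrite msuppX inE => /eqP-> ->; rewrite mnmDE mnm1E eqxx addn1.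
rewrite -[RHS]Y_sum; under [RHS]eq_bigr do rewrite YE mulr_suml.
rewrite (exchange_big_dep predT) //=; apply: eq_bigr => i _.
by rewrite mulr_sumr.
Qed.

Definition restricts_to (Y : fam) (B : {set 'I_k.+1}) (g : Q) : Prop :=
  forall A, A != set0 -> restr A (Y A) = if A == B then g else 0.

(** To make the sum 0, a monomial lifted to [B] is put a second time at one of its
    own variables, where its restriction vanishes. Positive degree provides this
    variable, and it differs from the linear form of [B] because the section
    avoids the pivot. *)
Lemma lift_family (D : pred nat) B (g : Q) : B != set0 ->
  (forall m, m \in msupp g -> (0 < mdeg m)%N && D (mdeg m)) ->
  exists Y, [/\ balanced Y, restricts_to Y B g &
                forall A m, m \in msupp (Y A) -> D (mdeg m)].
Proof.
move=> B0 gP; apply: (@mpoly2_supp_ind _ (fun g : Q => exists Y, [/\ balanced Y,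
  restricts_to Y B g & forall A m, m \in msupp (Y A) -> D (mdeg m)])).
- exists 0; split; [exact: balanced0 | | by move=> A m; rewrite ffunE msupp0].
  by move=> A _; rewrite ffunE raddf0 if_same.
- move=> g1 g2 [Y [vY rY dY]] [Z [vZ rZ dZ]]; exists (Y + Z).
  split; [exact: balancedD | |].
    by move=> A A0; rewrite ffunE raddfD /= rY // rZ //; case: ifP; rewrite ?addr0.
  by move=> A m; rewrite ffunE => /msuppD_le; rewrite mem_cat => /orP[/dY|/dZ].
move=> m /gP /andP[m_gt0 Dm].
have [j mj] : exists j, m j != 0%N by apply: mnm_neq0; rewrite -mdeg_eq0 -lt0n.
pose c := lift (pivot B) j; pose s : P := sect B 'X_[m].
have c_neq_B : [set c] != B.
  apply/eqP => cB; have pB := pivot_in B0.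
  move/setP/(_ (pivot B)): cB; rewrite in_set1 /c pB.
  by rewrite (negbTE (neq_lift _ _)).
have s_div : s = 'X_c * sect B 'X_[m - U_(j)].
  have le_jm : (U_(j) <= m)%MM by rewrite lep1mP.
  by rewrite /s -{1}(submK le_jm) mpolyXD /sect lsubstM lsubstX mulrC.
have s_homog : s \is (mdeg m).-homog.
  apply: lsubstX_homog => i; rewrite dhomogX; apply/eqP; exact: mdeg1.
exists (single B s + single [set c] s); split.
- split.
    rewrite !ffunE ![set0 == _]eq_sym (negbTE B0) -cards_eq0 cards1 /= addr0 //.
  under eq_bigr do rewrite ffunE.
  by rewrite big_split /= !sum_single mpolyDD.
- move=> A A0; rewrite !ffunE; case: eqP => [->|_].
    by rewrite eq_sym (negbTE c_neq_B) addr0 restr_sect.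
  rewrite add0r; case: eqP => [->|_]; last by rewrite raddf0.
  by rewrite s_div restrM -lform1 restr_lform ?mul0r // -cards_eq0 cards1.
move=> A m' ; rewrite !ffunE => /msuppD_le; rewrite mem_cat => /orP[].
  by case: ifP => _ /=; rewrite ?msupp0 // => /(dhomog_mf s_homog)/= ->.
by case: ifP => _ /=; rewrite ?msupp0 // => /(dhomog_mf s_homog)/= ->.
Qed.

(** Lift [g] and apply Sq^i to the family; the constant term of [g], which has no lift,
    is killed by Sq^i. *)
Lemma lift_hits B (h : Q) : B != set0 -> h \in @hits k ->
  exists Y, [/\ balanced Y, restricts_to Y B h & forall A, Y A \in @hits k.+1].
Proof.
move=> B0; elim/hits_ind => [|g1 g2 [Y [vY rY hY]] [Z [vZ rZ hZ]]|i g i_gt0].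
- exists 0; split; [exact: balanced0 | | by move=> A; rewrite ffunE rpred0].
  by move=> A _; rewrite ffunE raddf0 if_same.
- exists (Y + Z); split; [exact: balancedD | |].
    by move=> A A0; rewrite ffunE raddfD /= rY // rZ //; case: ifP; rewrite ?addr0.
  by move=> A; rewrite ffunE; exact: rpredD (hY A) (hZ A).
pose c := g@_0 *: 1 : Q.
have [|Y [vY rY _]] := @lift_family predT B (g + c) B0.
  move=> m; rewrite mcoeff_msupp andbT lt0n mdeg_eq0; apply: contraNneq => ->.
  rewrite mcoeffD mcoeffZ mcoeff1 eqxx mulr1.
  by rewrite -mulr2n -mulr_natr natr2_F2 mulr0.
exists (sqfam i Y); split; [exact: balanced_sqfam | | by move=> A; rewrite ffunE sq_hit].
move=> A A0; rewrite ffunE -sq_restr rY //; case: eqP => _; last by rewrite sqf0.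
rewrite sqD linearZ /= sq1 eqn0Ngt i_gt0 scaler0 addr0 //.
Qed.

(** Subtracting a family of hits with the same restrictions leaves a family of
    multiples of the linear forms. *)
Lemma Psi_restr_hits Y : balanced Y ->
  (forall A, A != set0 -> restr A (Y A) \in @hits k) -> Psi Y \in hitmod d.
Proof.
move=> vY hY.
have /choice[Z ZP] (B : {set 'I_k.+1}) : exists Z, B != set0 ->
    [/\ balanced Z, restricts_to Z B (restr B (Y B)) & forall A, Z A \in @hits k.+1].
  case: (boolP (B == set0)) => [_|B0]; first by exists 0.
  by have [Z ZP] := lift_hits B0 (hY B B0); exists Z.
pose W := \sum_(B : {set 'I_k.+1} | B != set0) Z B.
have vW : balanced W by apply: balanced_sum => B /ZP[].
have rW A : A != set0 -> restr A (W A) = restr A (Y A).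
  move=> A0; rewrite sum_ffunE raddf_sum (bigD1 A) //= big1 ?addr0.
    by have [_ rZ _] := ZP A A0; rewrite rZ ?eqxx.
  move=> B /andP[/ZP[_ rZ _] BA]; by rewrite rZ // eq_sym (negbTE BA).
have hW A : W A \in @hits k.+1.
  by rewrite sum_ffunE; apply: rpred_sum => B /ZP[_ _]; apply.
have vYW := balancedD vY vW.
have /choice[q YWE] A : exists q, (Y + W) A = lform A * q.
  case: (eqVneq A set0) => [->|A0].
    by exists 0; rewrite mulr0; case: vYW.
  have [q YWE] := restr_split ((Y + W) A) A0; exists q.
  rewrite YWE; rewrite ffunE raddfD /= rW // mpolyDD raddf0 add0r //.
have -> : Y = (Y + W) + W.
  apply/ffunP => A; rewrite !ffunE -addrA mpolyDD addr0 //.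
rewrite raddfD rpredD //; last exact: Psi_hits.
by apply: (Psi_lform YWE); case: vYW.
Qed.

(** By [Phi_digits] the left-hand side is the restriction of the sum of [zeta Y S] over
    the subsets S of [B], and [zeta] is an involution. *)
Lemma Phi_Psi Y B : balanced Y -> B != set0 -> Phi B d (Psi Y) = restr B (Y B).
Proof.
move=> vY B0; rewrite /Psi raddf_sum /=.
have Phi_spread S : Phi B d (digits (spread S) (zeta Y S)) =
    if S \subset B then restr B (zeta Y S) else 0.
  case: (boolP ((S == set0) || (S == setT))) => [S0T|].
    by rewrite balanced_zeta // digits0 Phi0 raddf0 if_same.
  rewrite negb_or => /andP[S0 ST].
  rewrite -{1}(size_spread (leq_card_spread ST)) Phi_digits //.
  congr (if _ then _ else _); apply/allP/subsetP => sub x.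
    by move=> xS; apply: sub; rewrite mem_spread.
  by rewrite mem_spread //; apply: sub.
under eq_bigr do rewrite Phi_spread.
rewrite -big_mkcond -raddf_sum /=; congr (restr B _).
rewrite /zeta (exchange_big_dep predT) //=.
rewrite (eq_bigr (fun A => if A == B then Y A else 0)) => [|A _].
  by rewrite -big_mkcond (big_pred1 B).
by rewrite -sum_interval; apply: eq_bigl => S; rewrite andbC.
Qed.

(** The degree of [digits J y] for y of degree [e] and J of size [d]. *)
Definition digits_deg e := iter d (fun n => k + n.*2)%N e.

(** The family is u_S (x) y, where u_S is the indicator of the sets containing S. *)
Lemma Psi_cone S (y : P) : S != set0 -> S != setT ->
  exists Y, [/\ balanced Y, Psi Y = digits (spread S) y &
    forall e, y \is e.-homog -> forall A, Y A \is e.-homog].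
Proof.
move=> S0 ST; pose Y : fam := [ffun A : {set _} => if S \subset A then y else 0].
have zetaY T : zeta Y T = if S == T then y else 0.
  rewrite -sum_interval /zeta [RHS]big_mkcond [LHS]big_mkcond /=.
  by apply: eq_bigr => A _; rewrite ffunE; case: (S \subset A); case: (A \subset T).
exists Y; split.
- split; first by rewrite ffunE subset0 (negbTE S0).
  transitivity (zeta Y setT); last by rewrite zetaY (negbTE ST).
  by rewrite /zeta; apply: eq_bigl => A; rewrite subsetT.
- rewrite /Psi (bigD1 S) //= zetaY eqxx big1 ?addr0 // => T TS.
  by rewrite zetaY eq_sym (negbTE TS) digits0.
by move=> e ye A; rewrite ffunE; case: ifP => _ //; exact: rpred0.
Qed.

(** If the entries of J form a proper subset, this is [Psi_cone]. Otherwise d > k, the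
    monomial is x_i z for some i, and [spread_sum] for the complement of i replaces
    it by a sum of products indexed by that complement. *)
Lemma Psi_digits_exists J m : size J = d -> (0 < mdeg m)%N ->
  exists Y, [/\ balanced Y, digits J 'X_[m] + Psi Y \in hitmod d &
                forall A, Y A \is (mdeg m).-homog].
Proof.
move=> szJ m_gt0; pose S := [set i in J].
have memJ : J =i S by move=> i; rewrite inE.
have S0 : S != set0.
  case: J szJ @S memJ => [d0|i J _ S _]; last first.
    by apply/set0Pn; exists i; rewrite inE mem_head.
  by move: le_kd; rewrite -d0 leqNgt k_gt0.
have Xm_homog : ('X_[m] : P) \is (mdeg m).-homog by rewrite dhomogX; apply/eqP.
have [ST|ST] := eqVneq S setT; last first.
  have [Y [vY PY hY]] := Psi_cone 'X_[m] S0 ST; exists Y.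
  by split; rewrite ?PY ?digits_spread //; apply: hY.
have [i mi] : exists i, m i != 0%N by apply: mnm_neq0; rewrite -mdeg_eq0 -lt0n.
pose z : P := 'X_[m - U_(i)].
have Xm : 'X_[m] = 'X_i * z.
  by rewrite -mpolyXD addmC submK // lep1mP.
have cardT : #|[set~ i]| = k by rewrite cardsC1 card_ord.
have T0 : [set~ i] != set0 by rewrite -cards_eq0 cardT -lt0n.
have TT : [set~ i] != setT.
  by apply/eqP => /setP/(_ i); rewrite !inE eqxx.
have lt_kd : (k < d)%N.
  have : (#|S| <= size J)%N by rewrite -(eq_card memJ) card_size.
  by rewrite ST cardsT card_ord szJ.
have z_homog : (\sum_(l | l != i) 'X_l * z : P) \is (mdeg m).-homog.
  apply: rpred_sum => l _; rewrite -mpolyXD dhomogX; apply/eqP.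
  have le_im : (U_(i) <= m)%MM by rewrite lep1mP.
  by rewrite /= -{2}(submK le_im) !mdegD !mdeg1 addnC.
have [Y [vY PY hY]] := Psi_cone (\sum_(l | l != i) 'X_l * z) T0 TT.
exists Y; split=> //; last by move=> A; apply: hY.
have := spread_sum z (_ : #|[set~ i]| < d)%N; rewrite cardT => /(_ lt_kd).
rewrite (bigD1 i) //= => sum_mod.
apply: (@hitmod_trans _ _ _ (digits (spread S) 'X_[m])); first exact: digits_spread.
rewrite PY raddf_sum Xm; have -> : S = i |: [set~ i].
  by rewrite ST; apply/setP => x; rewrite !inE orbN.
rewrite (eq_bigr (fun l => digits (spread (l |: [set~ i])) ('X_l * z))) //.
by move=> l li; rewrite (setUidPr _) // sub1set !inE.
Qed.

Lemma full_digitsP (e : nat) (m : 'X_{1..k.+1}) : full_digits e m ->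
  exists J m', size J = e /\ 'X_[m] = digits J 'X_[m'] :> P.
Proof.
elim: e m => [|e IH] m; first by exists [::], m.
rewrite /= => /andP[/eqP odds_m /IH[J [m' [<- def_half]]]].
have [j def_m] : exists j, m = (all_but j + half_mnm m *+ 2)%MM by exact: mnm_digit.
exists (j :: J), m'; split=> //.
by rewrite digits_cons -def_half digitX -def_m.
Qed.

Lemma digits_homog J e (y : P) : size J = d ->
  y \is e.-homog -> digits J y \is (digits_deg e).-homog.
Proof.
rewrite /digits_deg => <- ye; elim: J => // j J IH; rewrite digits_cons digit.unlock.
apply: dhomogM.
  rewrite dhomogX; apply/eqP; transitivity #|[set~ j]|.
    by apply: mdeg_set => i; rewrite mnmE !inE.
  exact: card_setC1.
by rewrite -muln2; apply: dhomogMn.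
Qed.

Lemma digits_deg_inj : injective digits_deg.
Proof.
rewrite /digits_deg; elim: (d) => // e IH m n /= /addnI /double_inj; exact: IH.
Qed.

Lemma Psi_homog Y e : balanced Y -> (forall A, Y A \is e.-homog) ->
  Psi Y \is (digits_deg e).-homog.
Proof.
move=> vY hY; apply: rpred_sum => S _.
case: (boolP ((S == set0) || (S == setT))) => [S0T|].
  by rewrite balanced_zeta // digits0 rpred0.
rewrite negb_or => /andP[S0 ST]; apply: digits_homog.
  by rewrite size_spread // leq_card_spread.
by apply: rpred_sum => A _; exact: hY.
Qed.

Lemma Psi_onto e (f : P) : (0 < e)%N -> f \is (digits_deg e).-homog ->
  exists Y, [/\ balanced Y, f + Psi Y \in hitmod d & forall A, Y A \is e.-homog].
Proof.
move=> e_gt0 /dhomog_mf f_deg; apply: (@mpoly2_supp_ind _ (fun f : P =>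
  exists Y, [/\ balanced Y, f + Psi Y \in hitmod d & forall A, Y A \is e.-homog])).
- exists 0; split; [exact: balanced0 | by rewrite Psi0 addr0 rpred0 |].
  by move=> A; rewrite ffunE rpred0.
- move=> g h [Y [vY PY hY]] [Z [vZ PZ hZ]]; exists (Y + Z).
  split; [exact: balancedD | by rewrite PsiD addrACA rpredD |].
  by move=> A; rewrite ffunE; exact: rpredD (hY A) (hZ A).
move=> m /f_deg /= m_deg; case: (boolP (full_digits d m)) => m_full; last first.
  exists 0; split; [exact: balanced0 | by rewrite Psi0 addr0 hitmodX |].
  by move=> A; rewrite ffunE rpred0.
have [J [m' [szJ def_m]]] := full_digitsP m_full.
have m'_deg : mdeg m' = e.
  apply: digits_deg_inj; rewrite -m_deg.
  have m_neq0 : 'X_[m] != 0 :> P by rewrite -msupp_eq0 msuppX.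
  apply: (dhomog_uniq m_neq0 (mf := mdeg)).
    by rewrite def_m; apply: digits_homog => //; rewrite dhomogX; apply/eqP.
  by rewrite dhomogX; apply/eqP.
by rewrite def_m -m'_deg; apply: Psi_digits_exists; rewrite // m'_deg.
Qed.

Lemma Phi_homog B e (f : P) : f \is (digits_deg e).-homog -> Phi B d f \is e.-homog.
Proof.
rewrite /digits_deg /Phi => /(restr_homog B); move: (restr B f) => g {f}.
elim: (d) e => // n IH e; rewrite iterSr iterS => g_homog.
by apply: kameko_homog; apply: IH.
Qed.

End Families.

(** * Comparison of the dimensions *)

Section Classes.
Variables (k n : nat).
Local Notation P := {mpoly 'F_2[k]}.

Fact deg_class_subproof (f : P) : QPclass (hcomp n f) \in @QPhomog k n.
Proof. by apply/asboolP; exists (hcomp n f) => //; exact: hcomp_homog. Qed.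

(** Totalized by taking the homogeneous component, so that it is additive on all
    polynomials. *)
Definition deg_class (f : P) : QPdeg k n := QPDeg (deg_class_subproof f).

Lemma deg_class_eq (f g : P) : f \is n.-homog -> g \is n.-homog ->
  (deg_class f == deg_class g) = (f + g \in @hits k).
Proof.
move=> fn gn; rewrite -val_eqE /= !hcomp_id // QPclass_eq mpolyN.
by [].
Qed.

Lemma deg_classD : {morph deg_class : f g / f + g}.
Proof. by move=> f g; apply: val_inj; rewrite /= hcompD QPclassD. Qed.

Lemma deg_class_surj (q : QPdeg k n) : exists f, f \is n.-homog /\ deg_class f = q.
Proof.
case: q => q qn; have /asboolP[f fn def_q] := qn; exists f; split=> //.
by apply: val_inj; rewrite /= hcomp_id.
Qed.

Lemma F2_linear (V W : lmodType 'F_2) (f : V -> W) : {morph f : x y / x + y} -> linear f.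
Proof.
move=> fD c x y; have f0 : f 0 = 0 by apply: (@addrI _ (f 0)); rewrite -fD !addr0.
by rewrite fD; have /orP[/eqP->|/eqP->] := F2P c; rewrite ?scale0r ?scale1r ?f0.
Qed.

End Classes.

Lemma dim_bij (F : fieldType) (V W : vectType F) (f : {linear V -> W}) :
  injective f -> (forall w, exists v, f v = w) -> \dim {:V} = \dim {:W}.
Proof.
move=> f_inj f_surj; pose h := linfun f.
have ker_h : lker h == 0%VS by apply/lker0P => u v; rewrite !lfunE => /f_inj.
have -> : {:W}%VS = limg h.
  apply/esym/eqP; rewrite eqEsubv subvf; apply/subvP => w _.
  have [v <-] := f_surj w; rewrite -[f v](lfunE f); exact: memv_img (memvf v).
by rewrite limg_dim_eq // (eqP ker_h) capv0.
Qed.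

Section Dimension.
Variables (k d e : nat).
Hypotheses (k_gt0 : (0 < k)%N) (le_kd : (k <= d)%N) (e_gt0 : (0 < e)%N).
Local Notation n := (digits_deg k d e).
Local Notation P := {mpoly 'F_2[k.+1]}.
Local Notation Q := {mpoly 'F_2[k]}.
Hypothesis hitmod_hit : forall f : P,
  f \is n.-homog -> f \in hitmod d -> f \in @hits k.+1.

(** Modulo hits the polynomial is [Psi Y], and then the restrictions of [Y] are hit. *)
Lemma Phi_inj (f : P) : f \is n.-homog ->
  (forall B, B != set0 -> Phi B d f \in @hits k) -> f \in @hits k.+1.
Proof.
move=> fn Phi_f; have [Y [vY fY hY]] := Psi_onto k_gt0 le_kd e_gt0 fn.
have Psi_n := Psi_homog le_kd vY hY.
have hit_fY : f + Psi d Y \in @hits k.+1 by apply: hitmod_hit; rewrite // rpredD.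
suff hit_Psi : Psi d Y \in @hits k.+1 by rewrite -(rpredDr _ hit_Psi).
apply: hitmod_hit => //; apply: Psi_restr_hits => // B B0.
rewrite -(Phi_Psi le_kd vY B0).
have := Phi_hits B d hit_fY; rewrite PhiD rpredDl //.
exact: Phi_f.
Qed.

Local Notation idx := {B : {set 'I_k.+1} | B != set0}.

Lemma Phi_surj (g : idx -> Q) : (forall B, g B \is e.-homog) ->
  exists f : P, f \is n.-homog /\ forall B : idx, Phi (val B) d f = g B.
Proof.
move=> ge; have /choice[Z ZP] (B : idx) : exists Y, [/\ balanced Y,
    restricts_to Y (val B) (g B) & forall A, Y A \is e.-homog].
  have [|Y [vY rY dY]] := @lift_family k (pred1 e) (val B) (g B) (valP B).
    by move=> m /(dhomog_mf (ge B))/= ->; rewrite e_gt0 eqxx.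
  by exists Y; split=> // A; apply/dhomogP => m /dY/eqP.
pose Y := \sum_B Z B.
have vY : balanced Y by apply: balanced_sum => B _; case: (ZP B).
exists (Psi d Y); split.
  apply: Psi_homog => // A; rewrite sum_ffunE; apply: rpred_sum => B _.
  by case: (ZP B).
move=> B; rewrite Phi_Psi ?(valP B) // sum_ffunE raddf_sum (bigD1 B) //=.
have rZ C : restr (val B) (Z C (val B)) = if val B == val C then g C else 0.
  by have [_ rZ _] := ZP C; exact: rZ (valP B).
rewrite rZ eqxx big1 ?addr0 // => C; rewrite rZ -val_eqE eq_sym => /negbTE->.
by [].
Qed.

Lemma card_idx : #|{: idx}| = (2 ^ k.+1 - 1)%N.
Proof.
rewrite card_sig -[X in (2 ^ X)%N]card_ord -cardsT -card_powerset subn1.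
rewrite (eq_card (B := predC1 (set0 : {set 'I_k.+1}))) // cardC1.
congr _.-1; apply: eq_card => A.
by rewrite [in RHS]inE subsetT.
Qed.

Lemma dim_QPdeg : \dim {: QPdeg k.+1 n} = ((2 ^ k.+1 - 1) * \dim {: QPdeg k e})%N.
Proof.
have /choice[rep repP] (q : QPdeg k.+1 n) := deg_class_surj q.
have rep_hit f : f \is n.-homog -> rep (deg_class n f) + f \in @hits k.+1.
  by move=> fn; have [rn rE] := repP (deg_class n f); rewrite -(deg_class_eq rn fn) rE.
pose theta (q : QPdeg k.+1 n) : {ffun idx -> QPdeg k e} :=
  [ffun B => deg_class e (Phi (val B) d (rep q))].
have PhiE B (f : P) : f \is n.-homog -> Phi B d f \is e.-homog by exact: Phi_homog.
have thetaE f B : f \is n.-homog ->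
    theta (deg_class n f) B = deg_class e (Phi (val B) d f).
  move=> fn; have [rn _] := repP (deg_class n f); rewrite ffunE.
  apply/eqP; rewrite deg_class_eq ?PhiE // -PhiD.
  exact/Phi_hits/rep_hit.
have thetaD : {morph theta : q r / q + r}.
  move=> q r; have [qn <-] := repP q; have [rn <-] := repP r.
  apply/ffunP => B; rewrite [RHS]ffunE -deg_classD !thetaE ?rpredD //.
  by rewrite PhiD deg_classD.
pose thetaL : {linear QPdeg k.+1 n -> {ffun idx -> QPdeg k e}} :=
  HB.pack theta (GRing.isLinear.Build _ _ _ _ theta (F2_linear thetaD)).
have theta_inj : injective thetaL.
  move=> q r; have [qn <-] := repP q; have [rn <-] := repP r => eq_theta.
  apply/eqP; rewrite deg_class_eq //; apply: Phi_inj; first exact: rpredD.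
  move=> B B0; move/ffunP/(_ (exist _ B B0)): eq_theta.
  rewrite /= !thetaE //= => /eqP; rewrite deg_class_eq ?PhiE //.
  by rewrite PhiD.
have theta_surj w : exists q, thetaL q = w.
  have /choice[g gP] (B : idx) := deg_class_surj (w B).
  have [|f [fn fP]] := Phi_surj (g := g); first by move=> B; case: (gP B).
  exists (deg_class n f); apply/ffunP => B; rewrite /= thetaE // fP.
  by case: (gP B).
rewrite (dim_bij theta_inj theta_surj) !dimvf -card_idx.
by [].
Qed.

End Dimension.

Lemma spike_deg_digits k c t : spike_exps k c -> (t <= c k)%N ->
  spike_deg k c 0 = digits_deg k t (spike_deg k c t).
Proof.
move=> c_spike; elim: t => // t IH lt_t; rewrite IH 1?ltnW //.
by rewrite /digits_deg iterSr -spike_degS.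
Qed.

Theorem theorem1p3 (k : nat) (d : nat -> nat)
    (d_pos : forall i, (1 <= i <= k - 1)%N -> (0 < d i)%N)
    (d_decr : forall i, (1 <= i < k - 2)%N -> (d i.+1 < d i)%N)
    (d_last : (d (k - 1) <= d (k - 2))%N)
    (k_ge : (3 <= k - 1)%N) (d_ge : (k - 1 <= d (k - 1))%N) :
  let n := (\sum_(1 <= i < k) (2 ^ d i - 1))%N in
  let m := (\sum_(1 <= i < k - 1) (2 ^ (d i - d (k - 1)) - 1))%N in
  (\dim {: QPdeg k n} = (2 ^ k - 1) * \dim {: QPdeg (k - 1) m})%N.
Proof.
case: k d_pos d_decr d_last k_ge d_ge => // k.
rewrite subSS subn0 subn2 -[k.+1.-2]/k.-1 => d_pos d_decr d_last k_ge d_ge n m.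
have d_spike : spike_exps k d by [].
have m_def : m = spike_deg k d (d k).
  rewrite /spike_deg big_nat_recr /=; last by lia.
  by rewrite subnn addn0.
have n_def : n = digits_deg k (d k) m.
  rewrite m_def -spike_deg_digits // /spike_deg.
  by apply: eq_bigr => i _; rewrite subn0.
(* There are at least three exponents, so the first one exceeds the last one. *)
have m_gt0 : (0 < m)%N.
  have d1 : (d k < d 1)%N.
    apply: leq_ltn_trans (d_decr 1 _); last by lia.
    by apply: (spike_exps_min d_spike); lia.
  rewrite /m big_ltn; last by lia.
  have -> : (d 1 - d k = (d 1 - d k).-1.+1)%N by lia.
  by rewrite expnS; have := expn_gt0 2 (d 1 - d k)%N.-1; lia.
rewrite n_def; apply: dim_QPdeg => //; first by lia.
move=> f f_homog; apply: (@hitmod_hits k.+1 d (d k) 0) => //.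
- by rewrite ltnS; lia.
- by rewrite addn0.
by rewrite (spike_deg_digits d_spike (leqnn _)) -m_def.
Qed.
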